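(* Let $X$ be a noncompact, locally compact, connected, locally connected Hausdorff space whose one-point compactification $\hat X$ has genus $0$. Suppose $\nu$ is a solid-set function on $\hat X$. For $A\in\mathscr{A}_s^*(X)$ define $\mu(A)=\nu(A)$. Then $\mu$ is a solid-set function on $X$ and, thus, extends uniquely to a topological measure on $X$.
   Context: All spaces are Hausdorff. A set is bounded if its closure is compact. ''Component'' means connected component. The empty set is regarded as connected. $\bigsqcup$ (or $\sqcup$) denotes a union of disjoint sets. $\mathscr{O}(Y)$, $\mathscr{C}(Y)$, $\mathscr{K}(Y)$ denote the open, closed, compact subsets of a space $Y$. Solid sets in a locally compact space $Y$: if $Y$ is noncompact, $A\subseteq Y$ is solid if $A$ is connected and every component of $Y\setminus A$ is unbounded; if $Y$ is compact, $A$ is solid if $A$ and $Y\setminus A$ are connected. $\mathscr{K}_s(Y)$ is the family of compact solid sets, $\mathscr{O}_s^*(Y)$ the family of bounded open solid sets, $\mathscr{A}_s^*(Y)=\mathscr{K}_s(Y)\cup\mathscr{O}_s^*(Y)$. (Every bounded solid set $A\in\mathscr{A}_s^*(X)$ is also solid in $\hat X$, and open or compact there, so $\nu(A)$ is defined.) A solid-set function on $Y$ is a function $\lambda:\mathscr{A}_s^*(Y)\to[0,\infty)$ such that: (s1) $\sum_{i=1}^n\lambda(C_i)\le\lambda(C)$ whenever $\bigsqcup_{i=1}^n C_i\subseteq C$ with $C,C_i\in\mathscr{K}_s(Y)$; (s2) $\lambda(U)=\sup\{\lambda(K):K\subseteq U,\ K\in\mathscr{K}_s(Y)\}$ for $U\in\mathscr{O}_s^*(Y)$;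 (s3) $\lambda(K)=\inf\{\lambda(U):K\subseteq U,\ U\in\mathscr{O}_s^*(Y)\}$ for $K\in\mathscr{K}_s(Y)$; (s4) $\lambda(A)=\sum_{i=1}^n\lambda(A_i)$ whenever $A=\bigsqcup_{i=1}^n A_i$ with $A,A_i\in\mathscr{A}_s^*(Y)$. Genus of a compact, connected, locally connected space $Y$: a solid partition of $Y$ is a finite disjoint collection $\{A_i\}_{i\in I}$ of nonempty sets, each open solid or closed solid, with $Y=\bigsqcup_{i\in I}A_i$. With $I'=\{i\in I: A_i \text{ closed}\}$, the partition is irreducible if $Y\setminus\bigsqcup_{i\in J}A_i$ is connected for every proper subset $J\subset I'$. The genus $g(Y)$ is the maximal value of $n-1$, where $n$ is the number of closed solid sets in an irreducible partition of $Y$, the maximum being over all irreducible partitions. A topological measure on $X$ is a set function $\mu:\mathscr{C}(X)\cup\mathscr{O}(X)\to[0,\infty]$, not identically $\infty$, such that: (TM1) $\mu(A\sqcup B)=\mu(A)+\mu(B)$ whenever $A,B,A\sqcup B\in\mathscr{K}(X)\cup\mathscr{O}(X)$; (TM2) $\mu(U)=\sup\{\mu(K):K\in\mathscr{K}(X),K\subseteq U\}$ for $U\in\mathscr{O}(X)$; (TM3) $\mu(F)=\inf\{\mu(U):U\in\mathscr{O}(X),F\subseteq U\}$ for $F\in\mathscr{C}(X)$. *)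

(* Defs.v *)
From HB Require Import structures.
From mathcomp Require Import all_boot all_order all_algebra.
From mathcomp Require Import all_classical all_reals ereal topology.
From mathcomp Require Import separation_axioms.

Set Implicit Arguments.
Unset Strict Implicit.
Unset Printing Implicit Defensive.

Import Order.TTheory GRing.Theory Num.Theory.

Local Open Scope classical_set_scope.
Local Open Scope ring_scope.

Definition locally_connected (Y : topologicalType) : Prop :=
  forall (x : Y) (U : set Y), nbhs x U ->
    exists V : set Y, [/\ open V, V x, V `<=` U & connected V].

Definition relatively_compact (Y : topologicalType) (A : set Y) : Prop :=
  compact (closure A).

(* The components of ~` A are the sets connected_component (~` A) x with x
   outside A; for x in A, connected_component (~` A) x is empty. *)
Definition solid (Y : topologicalType) (A : set Y) : Prop :=
  (~ compact [set: Y] ->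
     connected A /\
     forall x, ~ A x -> ~ relatively_compact (connected_component (~` A) x)) /\
  (compact [set: Y] -> connected A /\ connected (~` A)).

Definition compact_solid (Y : topologicalType) (K : set Y) : Prop :=
  compact K /\ solid K.

Definition bounded_open_solid (Y : topologicalType) (U : set Y) : Prop :=
  [/\ open U, relatively_compact U & solid U].

Definition bounded_solid (Y : topologicalType) (A : set Y) : Prop :=
  compact_solid A \/ bounded_open_solid A.

(* lam has the values of a function bounded_solid -> [0, oo[; its values on
   other sets are irrelevant. The supremum and infimum are taken in \bar R,
   where they need no boundedness side condition. *)
Record solid_set_function (R : realType) (Y : topologicalType)
    (lam : set Y -> R) : Prop := SolidSetFunction {
  ssf_ge0 : forall A, bounded_solid A -> 0 <= lam A ;
  ssf_superadditive : forall (n : nat) (D : 'I_n -> set Y) (C : set Y),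
    (forall i, compact_solid (D i)) -> compact_solid C ->
    trivIset setT D -> \bigcup_i D i `<=` C ->
    \sum_(i < n) lam (D i) <= lam C ;
  ssf_inner : forall U, bounded_open_solid U ->
    (lam U)%:E =
    ereal_sup [set (lam K)%:E | K in [set K | compact_solid K /\ K `<=` U]] ;
  ssf_outer : forall K, compact_solid K ->
    (lam K)%:E =
    ereal_inf [set (lam U)%:E
              | U in [set U | bounded_open_solid U /\ K `<=` U]] ;
  ssf_additive : forall (n : nat) (D : 'I_n -> set Y) (A : set Y),
    (forall i, bounded_solid (D i)) -> bounded_solid A ->
    trivIset setT D -> A = \bigcup_i D i ->
    lam A = \sum_(i < n) lam (D i)
}.

Definition solid_partition (Y : topologicalType) (n : nat)
    (A : 'I_n -> set Y) : Prop :=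
  [/\ forall i, A i !=set0,
      forall i, (open (A i) \/ closed (A i)) /\ solid (A i),
      trivIset setT A &
      \bigcup_i A i = [set: Y]].

Definition closed_index (Y : topologicalType) (n : nat)
    (A : 'I_n -> set Y) : pred 'I_n :=
  fun i => `[< closed (A i) >].

Definition irreducible_partition (Y : topologicalType) (n : nat)
    (A : 'I_n -> set Y) : Prop :=
  solid_partition A /\
  forall J : {set 'I_n}, J \proper closed_index A ->
    connected (~` \bigcup_(i in [set` J]) A i).

(* g is the maximum of k - 1, where k is the number of closed sets of an
   irreducible partition; g.+1 avoids truncated subtraction. *)
Definition has_genus (Y : topologicalType) (g : nat) : Prop :=
  (exists (n : nat) (A : 'I_n -> set Y),
     irreducible_partition A /\ #|closed_index A| = g.+1) /\
  (forall (n : nat) (A : 'I_n -> set Y),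
     irreducible_partition A -> (#|closed_index A| <= g.+1)%N).

(* mu has the values of a set function on the closed and open sets only; its
   values on other sets are irrelevant. *)
Record topological_measure (R : realType) (X : topologicalType)
    (mu : set X -> \bar R) : Prop := TopologicalMeasure {
  tm_ge0 : forall A, closed A \/ open A -> (0 <= mu A)%E ;
  tm_not_infinite : exists2 A, closed A \/ open A & mu A <> +oo%E ;
  tm_additive : forall A B,
    compact A \/ open A -> compact B \/ open B ->
    compact (A `|` B) \/ open (A `|` B) -> A `&` B = set0 ->
    mu (A `|` B) = (mu A + mu B)%E ;
  tm_inner : forall U, open U ->
    mu U = ereal_sup [set mu K | K in [set K | compact K /\ K `<=` U]] ;
  tm_outer : forall F, closed F ->
    mu F = ereal_inf [set mu U | U in [set U | open U /\ F `<=` U]]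
}.

Definition extends_solid_set_function (R : realType) (X : topologicalType)
    (lam : set X -> R) (mu : set X -> \bar R) : Prop :=
  forall A, bounded_solid A -> mu A = (lam A)%:E.

(* Main.v *)
Require Import Defs.
From HB Require Import structures.
From mathcomp Require Import all_boot all_order all_algebra.
From mathcomp Require Import all_classical all_reals ereal topology.
From mathcomp Require Import separation_axioms.
From mathcomp Require Import lra.

Set Implicit Arguments.
Unset Strict Implicit.
Unset Printing Implicit Defensive.

Import Order.TTheory GRing.Theory Num.Theory.

Local Open Scope classical_set_scope.
Local Open Scope ring_scope.

(** In a compact, connected, locally connected Hausdorff space of genus zero,
finitely many disjoint closed solid sets never separate the space: a minimal
separating family, together with the finitely many open pieces that it cuts
out, would be an irreducible partition with two closed members
([minimal_separation_partition]). By approximation from inside the same holds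
for disjoint open solid sets ([open_solids_do_not_separate]). So any finite
list of disjoint open solid sets [V_1, ..., V_k] consists of the complementary
components of a compact connected set, called a tile here, and additivity
forces the value on it of any extension of the solid-set function [lam]: the
total mass minus the sum of the [lam V_i], the weight of the tile.

The content of an open set is the supremum of the total weights of the finite
families of disjoint tiles inside it, and a closed set receives the total mass
minus the content of its complement. Everything rests on two inequalities for a
finite disjoint family of tiles: its total weight is at most the total mass
([tiling_weight_le]), and the complement of its union has at least the
remaining mass as content ([content_complement_ge]). Both follow by
[tiling_induction]: a tile with complementary components [V_1, ..., V_k] is
replaced, separately inside each [V_i], by the solid set [~` V_i], until all
tiles are solid. For solid tiles the first inequality is the superadditivity of
[lam]; for the second, the tiles are enlarged to open solid sets of almost the
same mass, whose complement is a single tile because the genus is zero. Since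
compact subsets of an open set are covered by tilings inside it
([tiling_cover]), the two inequalities give the regularity of the content, from
which additivity is formal ([extension_additive]).

This applies to the one-point compactification of [X], which is again connected
and locally connected. A bounded open or compact subset of [X] is solid in [X]
exactly when it is solid in the compactification ([compact_solid_hat],
[bounded_open_solid_hat]); for open sets this is boundary bumping
([component_reaches_boundary]). Hence [mu] inherits the axioms of [nu], and as
compact and open subsets of [X] are closed and open in the compactification,
the extension of [nu] restricts to a topological measure on [X]. It is the only
one: a tile that misses infinity is a compact solid set minus finitely many
bounded open solid sets, so its measure must be its weight ([tm_region]), and
tilings exhaust the open sets. *)

(** * Finite families of sets *)

Section FiniteFamilies.
Variable T : Type.
Implicit Types (A B : set T) (s : seq (set T)).

Definition union s : set T := [set x | exists2 A, A \in s & A x].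

(** A nonempty set occurs at most once in such a list; the empty set may be
repeated. *)
Definition disjoint_family s := pairwise (fun A B => A `&` B == set0) s.

Lemma union_sup s A : A \in s -> A `<=` union s.
Proof. by move=> As x Ax; exists A. Qed.

Lemma union_nil : union [::] = set0.
Proof. by rewrite -subset0 => x []. Qed.

Lemma union_cons A s : union (A :: s) = A `|` union s.
Proof.
apply/seteqP; split => x.
  by move=> [B]; rewrite inE => /predU1P[->|Bs] Bx; [left|right; exists B].
by move=> [Ax|[B Bs Bx]]; [exists A => //; rewrite mem_head|
  exists B => //; rewrite inE Bs orbT].
Qed.

Lemma union1 A : union [:: A] = A.
Proof. by rewrite union_cons union_nil setU0. Qed.

Lemma union_cat s s' : union (s ++ s') = union s `|` union s'.
Proof.
by elim: s => [|A s IH]/=; rewrite ?union_nil ?set0U// !union_cons IH setUA.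
Qed.

Lemma eq_mem_union s s' : s =i s' -> union s = union s'.
Proof.
by move=> ss'; apply/seteqP; split => x [A As Ax]; exists A => //;
  rewrite ?ss' // -ss'.
Qed.

Lemma disjoint_familyP s A B x : disjoint_family s -> A \in s -> B \in s ->
  A x -> B x -> A = B.
Proof.
elim: s => //= C s IH; rewrite /disjoint_family /= => /andP[/allP Cs ds].
rewrite !inE => /predU1P[->|As] /predU1P[->|Bs] // Ax Bx; last exact: IH.
  by have /eqP/seteqP[/(_ x)] := Cs _ Bs; case.
by have /eqP/seteqP[/(_ x)] := Cs _ As; case.
Qed.

Lemma disjoint_family_cons A s : disjoint_family (A :: s) <->
  A `&` union s = set0 /\ disjoint_family s.
Proof.
rewrite /disjoint_family /=; split.
  move=> /andP[/allP h ds]; split => //.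
  rewrite -subset0 => x [Ax [B Bs Bx]].
  by have /eqP/seteqP[/(_ x)] := h _ Bs; case.
move=> [h ds]; apply/andP; split => //; apply/allP => B Bs.
by apply/eqP; rewrite -subset0 -h => x [Ax Bx]; split => //; exists B.
Qed.

Lemma disjoint_family_cat s s' : disjoint_family (s ++ s') <->
  [/\ disjoint_family s, disjoint_family s' & union s `&` union s' = set0].
Proof.
elim: s => [|A s IH]; first by rewrite union_nil set0I; split => [|[]].
rewrite cat_cons; split.
  move=> /disjoint_family_cons[]; rewrite union_cat setIUr setU_eq0.
  move=> [As0 As'0] /IH[ds ds' ss0]; split => //; first exact/disjoint_family_cons.
  by rewrite union_cons setIUl As'0 ss0 setU0.
move=> [/disjoint_family_cons[As0 ds] ds'].
rewrite union_cons setIUl setU_eq0 => -[As'0 ss0].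
apply/disjoint_family_cons; split; last exact/IH.
by rewrite union_cat setIUr As0 As'0 setU0.
Qed.

Lemma disjoint_family_move A s s' :
  disjoint_family (s ++ A :: s') -> disjoint_family (A :: s ++ s').
Proof.
move=> /disjoint_family_cat[ds /disjoint_family_cons[As' ds']].
rewrite union_cons setIUr setU_eq0 => -[sA ss'].
apply/disjoint_family_cons; split; last exact/disjoint_family_cat.
by rewrite union_cat setIUr (setIC A) sA As' setU0.
Qed.

Lemma disjoint_family_map s (f : set T -> set T) :
  (forall A, A \in s -> f A `<=` A) -> disjoint_family s ->
  disjoint_family (map f s).
Proof.
rewrite /disjoint_family pairwise_map => fA.
apply: (sub_in_pairwise (P := mem s)); last exact/allP.
move=> A B As Bs /eqP AB /=; apply/eqP; rewrite -subset0 -AB.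
by move=> x [? ?]; split; apply: fA.
Qed.

Lemma trivIset_nth s : disjoint_family s ->
  trivIset setT (fun i : 'I_(size s) => nth set0 s i).
Proof.
move=> ds; apply/trivIsetP => i j _ _ ij.
wlog lij : i j ij / (i < j)%N.
  move=> h; have [lij|lji|/val_inj e] := ltngtP i j; first exact: (h i j).
    by rewrite setIC; apply: (h j i); rewrite // eq_sym.
  by rewrite e eqxx in ij.
exact/eqP/(pairwiseP set0 ds _ _ (ltn_ord i) (ltn_ord j) lij).
Qed.

Lemma bigcup_nth s : \bigcup_(i : 'I_(size s)) nth set0 s i = union s.
Proof.
apply/seteqP; split=> x.
  by move=> [i _ si]; exists (nth set0 s i) => //; exact: mem_nth.
move=> [A As Ax]; have lt : (index A s < size s)%N by rewrite index_mem.
by exists (Ordinal lt) => //=; rewrite nth_index.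
Qed.

Lemma union_enum (I : finType) (A : I -> set T) (J : {set I}) :
  union [seq A i | i <- enum J] = \bigcup_(i in [set` J]) A i.
Proof.
apply/seteqP; split=> x.
  by move=> [B /mapP[i]]; rewrite mem_enum => iJ -> Bx; exists i.
by move=> [i iJ Aix]; exists (A i) => //; apply: map_f; rewrite mem_enum.
Qed.

Lemma disjoint_family_enum (I : finType) (A : I -> set T) (J : {set I}) :
  trivIset setT A -> disjoint_family [seq A i | i <- enum J].
Proof.
move=> /trivIsetP tA; rewrite /disjoint_family pairwise_map.
apply: (sub_pairwise (r := [rel i j | i != j])).
  by move=> i j /= ij; apply/eqP; exact: tA.
by rewrite -uniq_pairwise enum_uniq.
Qed.

End FiniteFamilies.

(** The form in which finite subcovers are used below. If the conclusion failed,
the sets [S] such that [F `\` S] satisfies [P] would form a proper filter on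
the compact set [F] without a cluster point in it. *)
Lemma compact_induction (T : topologicalType) (P : set T -> Prop) (F : set T) :
  P set0 -> (forall A B, P A -> P B -> P (A `|` B)) ->
  (forall A B, A `<=` B -> P B -> P A) -> compact F ->
  (forall x, F x -> exists2 W, nbhs x W & P W) -> P F.
Proof.
move=> P0 PU PS cF loc; apply: contrapT => nPF.
pose G : set_system T := [set S | P (F `\` S)].
have FG : ProperFilter G.
  split; first by rewrite /G /= setD0.
  split => [|A B PA PB|A B AB]; rewrite /G /mkset.
  - by rewrite setDT.
  - by rewrite setDIr; apply: PU.
  - by apply: PS; apply: setDS.
have [|x [Fx clx]] := cF G FG; first by rewrite /G /= setDv.
have [W xW PW] := loc x Fx.
have GW : G (~` W) by apply: PS PW => y [_ /contrapT].
by have [y [nWy Wy]] := clx _ _ GW xW.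
Qed.

(** * Connectedness in locally connected spaces *)

Section Connectedness.
Variable T : topologicalType.
Implicit Types A B U V : set T.

Lemma connected_open_split A U V : connected A -> open U -> open V ->
  A `<=` U `|` V -> A `&` U `&` V = set0 -> A `<=` U \/ A `<=` V.
Proof.
move=> cA oU oV AUV AUV0.
have [[x [Ax Ux]]|AU0] := pselect ((A `&` U) !=set0); last first.
  right => x Ax; have [Ux|//] := AUV _ Ax.
  by exfalso; apply: AU0; exists x.
left; suff <- : A `&` U = A by move=> ? [].
apply: cA; [by exists x|by exists U|exists (~` V); first exact: open_closedC].
apply/seteqP; split=> y [Ay Uy]; split=> //; last by have [] := AUV _ Ay.
by move=> Vy; have : (A `&` U `&` V) y by []; rewrite AUV0.
Qed.

Lemma connected_open_splitP A :
  (forall U V, open U -> open V -> A `<=` U `|` V -> A `&` U `&` V = set0 ->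
     A `<=` U \/ A `<=` V) -> connected A.
Proof.
move=> h B [x Bx] [U oU BU] [F cF BF].
have [| |AU|AF] := h U (~` F) oU (closed_openC cF).
- move=> y Ay; have [Uy|nUy] := pselect (U y); first by left.
  right => Fy; apply: nUy.
  have : (A `&` U) y by rewrite -BU BF.
  by case.
- by rewrite -BU BF -setIA setICr setI0.
- by rewrite BU; exact/setIidPl.
- by move: Bx; rewrite BF => -[/AF].
Qed.

Lemma connected_between A B :
  connected A -> A `<=` B -> B `<=` closure A -> connected B.
Proof.
move=> cA AB BA; apply: connected_open_splitP => U V oU oV BUV BUV0.
have half W W' : open W' -> B `&` W `&` W' = set0 ->
    B `<=` W `|` W' -> A `<=` W -> B `<=` W.
  move=> oW' W0 BW AW x Bx; have [//|W'x] := BW _ Bx.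
  have [y [Ay W'y]] := BA _ Bx W' (open_nbhs_nbhs (conj oW' W'x)).
  have : (B `&` W `&` W') y by split => //; split; [exact: AB|exact: AW].
  by rewrite W0.
have [| |AU|AV] := connected_open_split cA oU oV; first exact: subset_trans BUV.
- by rewrite -subset0 -BUV0 => x [[Ax Ux] Vx]; split => //; split => //; apply: AB.
- by left; apply: (half U V).
- by right; apply: (half V U) => //; rewrite 1?setUC // -setIA (setIC V) setIA.
Qed.

Lemma connectedU_adherent A B : connected A -> connected B ->
  closure A `&` B !=set0 -> connected (A `|` B).
Proof.
move=> cA cB [x [Ax Bx]].
have -> : A `|` B = (A `|` [set x]) `|` B.
  by rewrite -setUA; congr (_ `|` _); apply/seteqP; split=> y;
    [right|case => [->|]].
apply: connectedU => //; first by exists x; split => //; right.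
apply: connected_between cA _ _; first by move=> ?; left.
by move=> y [/subset_closure//|->].
Qed.

(** Adding limit points to a connected set keeps it connected, so a component is
relatively closed. *)
Lemma closure_component A x :
  closure (connected_component A x) `&` A `<=` connected_component A x.
Proof.
move=> y [cy Ay]; have [Ax|nAx] := pselect (A x); last first.
  by move: cy; rewrite connected_component_out // closure0.
exists (closure (connected_component A x) `&` A) => //; split.
- by split => //; apply: subset_closure; apply: connected_component_refl.
- by move=> ? [].
- apply: connected_between (@component_connected _ A x) _ _; last by move=> ? [].
  by move=> z zC; split; [exact: subset_closure|exact: connected_component_sub zC].
Qed.

Lemma component_absorbs A B x : connected B -> B `<=` A ->
  B `&` connected_component A x !=set0 -> B `<=` connected_component A x.
Proof.
move=> cB BA [y [By xy]] z Bz; apply: connected_component_trans xy _.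
exact: connected_component_max By BA cB _ Bz.
Qed.

Hypothesis lconn : locally_connected T.

Lemma component_open A x : open A -> open (connected_component A x).
Proof.
move=> oA; rewrite openE => y xy.
have Ay := connected_component_sub xy.
have [V [oV Vy VA cV]] := lconn (open_nbhs_nbhs (conj oA Ay)).
apply: (filterS _ (open_nbhs_nbhs (conj oV Vy))).
by apply: component_absorbs => //; exists y.
Qed.

(** The components of an open set are open and disjoint, so finitely many of them
cover a compact part of it. *)
Lemma finitely_many_components (V F : set T) : open V -> compact F -> F `<=` V ->
  exists us, [/\ forall U, U \in us ->
                   exists2 x, V x & U = connected_component V x,
                 disjoint_family us & F `<=` union us].
Proof.
move=> oV cF FV.
pose comp U := exists2 x, V x & U = connected_component V x.
have [us [usV Fus]] : exists us, (forall U, U \in us -> comp U) /\ F `<=` union us.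
  pose P F := exists us, (forall U, U \in us -> comp U) /\ F `<=` union us.
  apply: (@compact_induction _ P F) => // [|A B|A B AB|x /FV Vx].
  - by exists [::]; split => //; rewrite union_nil.
  - move=> [s [sV As]] [t [tV Bt]]; exists (s ++ t); split.
      by move=> U; rewrite mem_cat => /orP[/sV|/tV].
    by rewrite union_cat; exact: setUSS.
  - by move=> [s [sV Bs]]; exists s; split => //; exact: subset_trans Bs.
  - exists (connected_component V x).
      apply: open_nbhs_nbhs; split; first exact: component_open.
      exact: connected_component_refl.
    exists [:: connected_component V x]; rewrite union1; split => // U.
    by rewrite inE => /eqP ->; exists x.
exists (undup us); split.
- by move=> U; rewrite mem_undup => /usV.
- rewrite /disjoint_family.
  apply: (sub_in_pairwise (P := mem us) (r := [rel A B | A != B])).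
  + move=> A B /usV[x Vx ->] /usV[y Vy ->] /= /eqP xy.
    apply/eqP; rewrite -subset0 => z [xz yz]; apply: xy.
    by rewrite (same_connected_component xz) (same_connected_component yz).
  + by apply/allP => U; rewrite mem_undup.
  + by rewrite -uniq_pairwise undup_uniq.
- by rewrite (eq_mem_union (mem_undup us)).
Qed.

Hypothesis conn : connected [set: T].

(** Otherwise the component would be clopen in a connected space. *)
Lemma closure_component_meets A x : closed A -> A !=set0 -> ~ A x ->
  closure (connected_component (~` A) x) `&` A !=set0.
Proof.
move=> cA [a Aa] nAx; apply: contrapT => h.
have AE : connected_component (~` A) x = setT.
  apply: conn; first by exists x; apply: connected_component_refl.
    exists (connected_component (~` A) x); last by rewrite setTI.
    by apply: component_open; apply: closed_openC.
  exists (closure (connected_component (~` A) x)); first exact: closed_closure.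
  rewrite setTI; apply/seteqP; split; first exact: subset_closure.
  move=> y yc; apply: closure_component; split => // Ay.
  by apply: h; exists y.
have : connected_component (~` A) x a by rewrite AE.
by move/connected_component_sub.
Qed.

(** Every other component of the complement clings to the connected set, so
removing one of them leaves a connected set: complementary components of
closed connected sets are solid. *)
Lemma component_coconnected A x : closed A -> connected A -> A !=set0 ->
  connected (~` connected_component (~` A) x).
Proof.
move=> clA cA [a Aa].
have -> : ~` connected_component (~` A) x =
    \bigcup_(y in ~` connected_component (~` A) x)
      (connected_component (~` A) y `|` A).
  apply/seteqP; split=> [y nxy|y [z nxz [zy|Ay]]].
  - have [Ay|nAy] := pselect (A y); first by exists y => //; right.
    by exists y => //; left; apply: connected_component_refl.
  - move=> xy; apply: nxz; apply: connected_component_trans xy _.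
    exact: connected_component_sym.
  - by move/connected_component_sub.
apply: bigcup_connected; first by exists a => ? _; right.
move=> y _; have [Ay|nAy] := pselect (A y).
  by rewrite connected_component_out ?set0U //; apply.
apply: connectedU_adherent => //; first exact: component_connected.
by apply: closure_component_meets => //; exists a.
Qed.

End Connectedness.

(** * Solid sets in a compact locally connected space *)

Section CompactSpace.
Variable Y : topologicalType.
Hypotheses (compY : compact [set: Y]) (hausY : hausdorff_space Y).
Hypotheses (connY : connected [set: Y]) (lconnY : locally_connected Y).
Implicit Types A B C D F G H K U V W : set Y.

Lemma closed_compactY A : closed A -> compact A.
Proof. by move=> cA; apply: subclosed_compact cA compY _. Qed.

Lemma compact_closedY A : compact A -> closed A.
Proof. exact: compact_closed. Qed.

Lemma closed_separation A B : closed A -> closed B -> A `&` B = set0 ->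
  exists U V, [/\ open U, open V, A `<=` U, B `<=` V & U `&` V = set0].
Proof.
move=> clA clB AB0.
have nAB : set_nbhs A (~` B).
  apply/set_nbhsP; exists (~` B); split => //; first exact: closed_openC.
  by move=> x Ax Bx; have : (A `&` B) x by []; rewrite AB0.
have [W /set_nbhsP[V [oV AV VW]] WB] := compact_normal hausY compY clA nAB.
exists V, (~` closure W); split => //.
- exact/closed_openC/closed_closure.
- by move=> x Bx /WB.
- by rewrite -subset0 => x [/VW /subset_closure].
Qed.

(** The two parts of a separation of a closed set are closed, and normality
provides disjoint open neighbourhoods of them. *)
Lemma disconnected_closed D : closed D -> ~ connected D ->
  exists N N', [/\ open N, open N', D `<=` N `|` N', N `&` N' = set0 &
    D `&` N !=set0 /\ D `&` N' !=set0].
Proof.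
move=> clD /connectedPn[E [E0 EU sepE]].
have [sep1 sep2] := sepE.
have clE b : closed (E b).
  rewrite closure_id eqEsubset; split; first exact: subset_closure.
  have clED : closure (E b) `<=` D.
    rewrite [X in _ `<=` X](closure_id _).1 //; apply: closureS.
    by rewrite EU; case: b; [right|left].
  move=> x Ex; have := clED _ Ex; rewrite EU; case: b Ex {clED} => Ex [Ex'|Ex'] //.
    by have : (E false `&` closure (E true)) x by []; rewrite sep2.
  by have : (closure (E false) `&` E true) x by []; rewrite sep1.
have [N [N' [oN oN' EN EN' NN'0]]] :=
  closed_separation (clE false) (clE true) (separated_disjoint sepE).
exists N, N'; split => //; first by rewrite EU; exact: setUSS.
split.
  by have [x Ex] := E0 false; exists x; split; [rewrite EU; left|exact: EN].
by have [x Ex] := E0 true; exists x; split; [rewrite EU; right|exact: EN'].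
Qed.

(** ** Components of compact sets *)

Definition relatively_clopen B H :=
  closed H /\ exists2 O, open O & H = B `&` O.

Lemma relatively_clopen_refl B : closed B -> relatively_clopen B B.
Proof. by split => //; exists setT; rewrite ?setIT //; exact: openT. Qed.

Lemma relatively_clopenI B H H' : relatively_clopen B H ->
  relatively_clopen B H' -> relatively_clopen B (H `&` H').
Proof.
move=> [cH [O oO HO]] [cH' [O' oO' HO']]; split; first exact: closedI.
by exists (O `&` O'); [exact: openI|rewrite HO HO' setIACA setIid].
Qed.

(** The relatively clopen sets that contain [x] are stable under finite
intersection, so by compactness one of them lies in any open set that contains
their intersection. *)
Lemma quasicomponent_neighborhood B x W : closed B -> B x -> open W ->
  (forall y, (forall H, relatively_clopen B H -> H x -> H y) -> W y) ->
  exists H, [/\ relatively_clopen B H, H x & H `<=` W].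
Proof.
move=> clB Bx oW QW.
pose P F := exists H, [/\ relatively_clopen B H, H x & H `&` F = set0].
have BB := relatively_clopen_refl clB.
have [||||y [By nWy]|H [cH Hx HBW]] := @compact_induction Y P (B `&` ~` W).
- by exists B; rewrite setI0.
- move=> A A' [H [cH Hx HA]] [H' [cH' H'x HA']]; exists (H `&` H'); split => //.
    exact: relatively_clopenI.
  by rewrite -subset0 => y [[Hy H'y] [Ay|Ay]]; [rewrite -HA|rewrite -HA'].
- move=> A A' AA' [H [cH Hx HA]]; exists H; split => //.
  by rewrite -subset0 -HA; exact: setIS.
- exact: closed_compactY (closedI clB (open_closedC oW)).
- have [H [cH Hx nHy]] : exists H, [/\ relatively_clopen B H, H x & ~ H y].
    apply: contrapT => h; apply: nWy; apply: QW => H cH Hx.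
    by apply: contrapT => nHy; apply: h; exists H.
  exists (~` H); last by exists H; split => //; exact: setICr.
  by apply: open_nbhs_nbhs; split => //; apply: closed_openC; case: cH.
exists H; split => // y Hy; apply: contrapT => nWy.
have : (H `&` (B `&` ~` W)) y.
  by split => //; split => //; case: cH => _ [O _ HO]; move: Hy; rewrite HO => -[].
by rewrite HBW.
Qed.

(** The quasi-component of [x] is connected: a relatively clopen set contained in
two disjoint open sets splits into two relatively clopen sets. *)
Lemma quasicomponent_sub_component B x y : closed B -> B x ->
  (forall H, relatively_clopen B H -> H x -> H y) ->
  connected_component B x y.
Proof.
move=> clB Bx Qy.
pose Q := [set z | forall H, relatively_clopen B H -> H x -> H z].
have BB := relatively_clopen_refl clB.
have clQ : closed Q.
  have -> : Q = \bigcap_(H in [set H | relatively_clopen B H /\ H x]) H.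
    apply/seteqP; split=> z Qz; first by move=> H [cH Hx]; apply: (Qz H).
    by move=> H cH Hx; apply: Qz.
  by apply: closed_bigI => H [[]].
have QB : Q `<=` B by move=> z /(_ B BB Bx).
apply: (@connected_component_max _ _ Q) => //.
apply: contrapT => /(disconnected_closed clQ)[N [N' [oN oN' QNN' NN'0 [QN QN']]]].
have contra M M' : open M -> open M' -> Q `<=` M `|` M' -> M `&` M' = set0 ->
    M x -> Q `&` M' !=set0 -> False.
  move=> oM oM' QM MM'0 Mx [z [Qz M'z]].
  have [H [[cH [O oO HO]] Hx HM]] :=
    quasicomponent_neighborhood clB Bx (openU oM oM') QM.
  have cHM : relatively_clopen B (H `&` M).
    split; last by exists (O `&` M); [exact: openI|rewrite HO setIA].
    have -> : H `&` M = H `&` ~` M'.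
      apply/seteqP; split=> w [Hw].
        move=> Mw; split => // M'w.
        by have : (M `&` M') w by []; rewrite MM'0.
      by move=> nM'w; split => //; have [|] := HM _ Hw.
    by apply: closedI => //; exact: open_closedC.
  have [_ Mz] := Qz _ cHM (conj Hx Mx).
  by have : (M `&` M') z by []; rewrite MM'0.
have [Nx|N'x] : (N `|` N') x by apply: QNN' => H.
  exact: contra Nx QN'.
by apply: (contra N' N) => //; rewrite 1?setUC 1?setIC.
Qed.

(** Boundary bumping: a relatively clopen neighbourhood of the component inside
[G] would be clopen in [C]. *)
Lemma component_reaches_boundary C G x : closed C -> connected C -> open G ->
  C x -> G x -> ~ C `<=` G ->
  ~ connected_component (C `&` closure G) x `<=` G.
Proof.
move=> clC cC oG Cx Gx nCG compG; apply: nCG.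
have clB : closed (C `&` closure G) by apply: closedI => //; exact: closed_closure.
have Bx : (C `&` closure G) x by split => //; exact: subset_closure.
have [y Qy|H [[cH [O oO HO]] Hx HG]] := quasicomponent_neighborhood clB Bx oG.
  by apply: compG; exact: quasicomponent_sub_component.
suff <- : H = C by [].
apply: cC; first by exists x.
- exists (O `&` G); first exact: openI.
  apply/seteqP; split=> y.
    by move=> Hy; have := HG _ Hy; move: Hy; rewrite HO => -[[? ?] ?].
  move=> [Cy [Oy Gy]]; rewrite HO; split => //; split => //.
  exact: subset_closure.
- exists H => //; apply/esym/setIidPr.
  by rewrite HO => y [[]].
Qed.

(** Regularity combined with local connectedness. *)
Lemma connected_shrink V x : open V -> V x ->
  exists W, [/\ open W, W x, connected W & closure W `<=` V].
Proof.
move=> oV Vx; have cx : closed [set x].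
  exact/accessible_closed_set1/hausdorff_accessible.
have [|U [U' [oU oU' xU VU' UU'0]]] :=
    closed_separation cx (open_closedC oV).
  by rewrite -subset0 => y [-> /(_ Vx)].
have [W [oW Wx WU cW]] := lconnY (open_nbhs_nbhs (conj oU (xU _ erefl))).
exists W; split => // y Wy; apply: contrapT => /VU' U'y.
have [z [/WU Uz U'z]] := Wy _ (open_nbhs_nbhs (conj oU' U'y)).
by have : (U `&` U') z by []; rewrite UU'0.
Qed.

Lemma closed_union s : (forall A, A \in s -> closed A) -> closed (@union Y s).
Proof.
elim: s => [|A s IH] cs; first by rewrite union_nil; exact: closed0.
rewrite union_cons; apply: closedU; first by apply: cs; rewrite mem_head.
by apply: IH => B Bs; apply: cs; rewrite inE Bs orbT.
Qed.

Lemma open_union s : (forall A, A \in s -> open A) -> open (@union Y s).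
Proof.
move=> os; rewrite openE => x [A As Ax].
apply: (filterS _ (open_nbhs_nbhs (conj (os _ As) Ax))); exact: union_sup.
Qed.

Lemma connected_sub_member A vs V x : connected A ->
  disjoint_family vs -> (forall W, W \in vs -> open W) -> A `<=` union vs ->
  V \in vs -> A x -> V x -> A `<=` V.
Proof.
move=> cA dvs ovs Avs Vvs Ax Vx.
have [||||//|An] := @connected_open_split _ A V
    (union [seq W <- vs | W != V]) cA.
- exact: ovs.
- by apply: open_union => W; rewrite mem_filter => /andP[_ /ovs].
- move=> y /Avs[W Wvs Wy]; have [<-|WV] := eqVneq W V; first by left.
  by right; exists W => //; rewrite mem_filter WV.
- rewrite -subset0 => y [[_ Vy] [W]]; rewrite mem_filter => /andP[/eqP WV Wvs].
  by move=> Wy; apply/WV/(disjoint_familyP dvs Wvs Vvs Wy Vy).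
- have [W] := An _ Ax; rewrite mem_filter => /andP[/eqP WV Wvs] Wx.
  by exfalso; apply/WV/(disjoint_familyP dvs Wvs Vvs Wx Vx).
Qed.

(** The points of [V] that are joined to a given one by a compact connected subset
of [V] form a set that is open and closed in [V], hence all of [V]; a compact
part of [V] is then joined by finitely many such subsets. *)
Lemma compact_connected_hull V F : open V -> connected V -> closed F ->
  F `<=` V -> exists K, [/\ closed K, connected K, F `<=` K & K `<=` V].
Proof.
move=> oV cV cF FV.
have [[p Fp]|F0] := pselect (F !=set0); last first.
  by exists set0; split; [exact: closed0|exact: connected0|
    move=> x Fx; apply: F0; exists x|].
pose joined A := exists K, [/\ closed K, connected K, K p, A `<=` K & K `<=` V].
have joinedU A B : joined A -> joined B -> joined (A `|` B).
  move=> [K [? ? Kp AK KV]] [L [? ? Lp BL LV]]; exists (K `|` L); split.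
  - exact: closedU.
  - by apply: connectedU => //; exists p.
  - by left.
  - exact: setUSS.
  - by move=> x [/KV|/LV].
have joinedS A B : A `<=` B -> joined B -> joined A.
  by move=> AB [K [? ? ? BK ?]]; exists K; split => //; exact: subset_trans BK.
have joined_near x : V x -> exists W, [/\ open W, W x &
    (exists2 y, W y & joined [set y]) -> joined W].
  move=> Vx; have [W [oW Wx cW WV]] := connected_shrink oV Vx.
  exists W; split => // -[y Wy [K [cK coK Kp yK KV]]].
  exists (K `|` closure W); split.
  - by apply: closedU => //; exact: closed_closure.
  - apply: connectedU; last exact: connected_closure.
      by exists y; split; [exact: yK|exact: subset_closure].
    by [].
  - by left.
  - by move=> z Wz; right; exact: subset_closure.
  - by move=> z [/KV|/WV].
pose Q := [set x | joined [set x]].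
have Qp : Q p.
  exists [set p]; split => //; last by move=> x ->; exact: FV.
    exact/accessible_closed_set1/hausdorff_accessible.
  exact: connected1.
have VQ : V `<=` Q.
  have oQ : open (V `&` Q).
    rewrite openE => x [Vx Qx]; have [W [oW Wx jW]] := joined_near _ Vx.
    apply: (filterS _ (open_nbhs_nbhs (conj (openI oV oW) (conj Vx Wx)))).
    move=> y [Vy Wy]; split => //; apply: joinedS (jW _); first by move=> z ->.
    by exists x.
  have onQ : open (V `&` ~` Q).
    rewrite openE => x [Vx nQx]; have [W [oW Wx jW]] := joined_near _ Vx.
    apply: (filterS _ (open_nbhs_nbhs (conj (openI oV oW) (conj Vx Wx)))).
    move=> y [Vy Wy]; split => // Qy; apply: nQx.
    by apply: joinedS (jW _); [move=> z ->|exists y].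
  have [| |VQ|VnQ] := connected_open_split cV oQ onQ.
  - by move=> x Vx; have [?|?] := pselect (Q x); [left|right].
  - by rewrite -subset0 => x [[_ [_ Qx]] [_]].
  - by move=> x /VQ[].
  - by have [_] := VnQ _ (FV _ Fp).
have [K [? ? _ FK KV]] : joined F; last by exists K.
apply: compact_induction => // [||x /FV Vx].
- by apply: joinedS Qp.
- exact: closed_compactY.
have [W [oW Wx jW]] := joined_near _ Vx.
by exists W; [exact: open_nbhs_nbhs|apply: jW; exists x => //; exact: VQ].
Qed.

Definition closed_solid K := [/\ closed K, connected K & connected (~` K)].
Definition open_solid V := [/\ open V, connected V & connected (~` V)].

Lemma closed_solidC K : closed_solid K -> open_solid (~` K).
Proof. by case=> *; split; rewrite ?setCK//; exact: closed_openC. Qed.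

Lemma open_solidC V : open_solid V -> closed_solid (~` V).
Proof. by case=> *; split; rewrite ?setCK//; exact: open_closedC. Qed.

Lemma closed_solidT : closed_solid setT.
Proof.
split; rewrite ?setCT; [exact: closedT|exact: connY|exact: connected0].
Qed.

Lemma open_solidT : open_solid setT.
Proof.
split; rewrite ?setCT; [exact: openT|exact: connY|exact: connected0].
Qed.

(** Fill in, inside [V], the holes of a compact connected set that contains
[F]: what is left outside is the one complementary component that contains the
connected set [~` V]. *)
Lemma closed_solid_hull V F : open_solid V -> closed F -> F `<=` V ->
  exists K, [/\ closed_solid K, F `<=` K & K `<=` V].
Proof.
move=> [oV cV ccV] cF FV.
have [K [cK coK FK KV]] := compact_connected_hull oV cV cF FV.
have [[p nVp]|V_T] := pselect (~` V !=set0); last first.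
  exists setT; split => //; first exact: closed_solidT.
  by move=> x _; apply: contrapT => nVx; apply: V_T; exists x.
have [[k Kk]|K0] := pselect (K !=set0); last first.
  exists set0; split => //.
  - by split; rewrite ?setC0; [exact: closed0|exact: connected0|exact: connY].
  - by move=> x /FK Kx; apply: K0; exists x.
have nKp : ~ K p by move=> /KV.
exists (~` connected_component (~` K) p); split.
- split; last by rewrite setCK; exact: component_connected.
    exact/open_closedC/component_open/closed_openC.
  by apply: component_coconnected => //; exists k.
- by move=> x /FK Kx /connected_component_sub.
- move=> x; apply: contra_notP => nVx.
  by apply: connected_component_max nVp _ ccV _ nVx; exact: subsetC.
Qed.

Lemma solidP A : solid A <-> connected A /\ connected (~` A).
Proof.
split; first by case=> _ /(_ compY).
by move=> ?; split.
Qed.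

Lemma compact_solidP K : compact_solid K <-> closed_solid K.
Proof.
split; first by case=> /compact_closedY cK /solidP[].
by case=> cK coK ccK; split; first exact: closed_compactY.
Qed.

Lemma bounded_open_solidP V : bounded_open_solid V <-> open_solid V.
Proof.
split; first by case=> oV _ /solidP[].
case=> oV coV ccV; split => //; exact/closed_compactY/closed_closure.
Qed.

(** ** Genus zero *)

Section MinimalSeparation.
Variable ss : seq (set Y).
Hypothesis solid_ss : forall S, S \in ss -> closed_solid S.
Hypothesis disj_ss : disjoint_family ss.
Hypothesis separates : ~ connected (~` union ss).
Hypothesis minimal : forall tt, (size tt < size ss)%N ->
  (forall S, S \in tt -> closed_solid S) -> disjoint_family tt ->
  connected (~` union tt).

Let O := ~` union ss.

Let openO : open O.
Proof. by apply/closed_openC/closed_union => S /solid_ss[]. Qed.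

(** Otherwise the component would be clopen in the connected set obtained by
dropping [S] from the family. *)
Let component_meets x S : O x -> S \in ss ->
  closure (connected_component O x) `&` S !=set0.
Proof.
move=> Ox Sss; apply: contrapT => h; apply: separates; rewrite -/O.
have /perm_to_rem prem := Sss.
have urem : union ss = S `|` union (rem S ss).
  by rewrite -union_cons; exact/eq_mem_union/perm_mem.
have cQ : connected (~` union (rem S ss)).
  apply: minimal; first by rewrite (perm_size prem).
    by move=> A /mem_rem /solid_ss.
  exact: subseq_pairwise (rem_subseq _ _) disj_ss.
suff <- : connected_component O x = O by exact: component_connected.
have OQ : O `<=` ~` union (rem S ss).
  by move=> y Oy ry; apply: Oy; rewrite urem; right.
have CQ : connected_component O x = ~` union (rem S ss).
  apply: cQ; first by exists x; exact: connected_component_refl.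
  - exists (connected_component O x); first exact: component_open.
    by apply/esym/setIidPr => y /connected_component_sub /OQ.
  - exists (closure (connected_component O x)); first exact: closed_closure.
    apply/seteqP; split=> y.
      by move=> xy; split; [exact: OQ (connected_component_sub xy)
        |exact: subset_closure].
    move=> [ny xy]; apply: closure_component; split => //.
    by rewrite /O urem => -[Sy|//]; apply: h; exists y.
apply/seteqP; split; first exact: connected_component_sub.
by rewrite CQ.
Qed.

Let two_members : exists S S' tt, ss = [:: S, S' & tt].
Proof.
case: ss solid_ss separates => [|S [|S' tt]] sol sep; last by exists S, S', tt.
- by exfalso; apply: sep; rewrite union_nil setC0.
- by exfalso; apply: sep; rewrite union1; have [] := sol S (mem_head _ _).
Qed.

(** Every component touches both [S] and the rest of the family, hence crosses
the compact frontier between disjoint neighbourhoods of these sets. *)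
Let finite_components : exists us, [/\ forall U, U \in us ->
     exists2 x, O x & U = connected_component O x,
   disjoint_family us, union us = O &
   forall x, O x -> connected_component O x \in us].
Proof.
have [S [S' [tt sse]]] := two_members.
have Sss : S \in ss by rewrite sse mem_head.
have S'ss : S' \in ss by rewrite sse !inE eqxx orbT.
have [SS'0 _] : S `&` union (S' :: tt) = set0 /\ disjoint_family (S' :: tt).
  by apply/disjoint_family_cons; rewrite -sse.
have [||U [V [oU oV SU S'V UV0]]] := closed_separation _ _ SS'0.
- by have [] := solid_ss Sss.
- by apply: closed_union => A At; have [] := @solid_ss A;
    rewrite // sse inE At orbT.
have Bdcl : closed (~` (U `|` V)) by exact/open_closedC/openU.
have BdO : ~` (U `|` V) `<=` O.
  move=> x nUV; rewrite /O sse union_cons => -[Sx|rx]; apply: nUV.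
    by left; exact: SU.
  by right; exact: S'V.
have [us [usP dus Bdus]] := 
  finitely_many_components lconnY openO (closed_compactY Bdcl) BdO.
have usall x : O x -> connected_component O x \in us.
  move=> Ox.
  have meet W A : open W -> A \in ss -> A `<=` W ->
      connected_component O x `&` W !=set0.
    move=> oW Ass AW; have [y [cy Ay]] := component_meets Ox Ass.
    exact: cy _ (open_nbhs_nbhs (conj oW (AW _ Ay))).
  have [y [xy ny]] : connected_component O x `&` ~` (U `|` V) !=set0.
    apply: contrapT => h.
    have CUV : connected_component O x `<=` U `|` V.
      by move=> y xy; apply: contrapT => ny; apply: h; exists y.
    have [] := connected_open_split (@component_connected _ O x) oU oV CUV _.
    - by rewrite -setIA UV0 setI0.
    - move=> CU; have [|y [/CU Uy Vy]] := meet V S' oV S'ss.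
        by apply: subset_trans S'V; apply: union_sup; rewrite mem_head.
      by have : (U `&` V) y by []; rewrite UV0.
    - move=> CV; have [|y [/CV Vy Uy]] := meet U S oU Sss; first by [].
      by have : (U `&` V) y by []; rewrite UV0.
  have [W Wus Wy] := Bdus _ ny.
  have [z Oz Wz] := usP _ Wus; rewrite Wz in Wus Wy.
  by rewrite (same_connected_component xy) -(same_connected_component Wy).
exists us; split => //; apply/seteqP; split=> x.
  by move=> [W /usP[z _ ->]] /connected_component_sub.
move=> Ox; exists (connected_component O x); first exact: usall.
exact: connected_component_refl.
Qed.

(** The other components all touch every member of the family; as there is at
least one of them, it holds the members together. *)
Let coconnected_component x : O x -> connected (~` connected_component O x).
Proof.
move=> Ox; have [y Oy nxy] : exists2 y, O y & ~ connected_component O x y.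
  apply: contrapT => h; apply: separates; rewrite -/O.
  suff <- : connected_component O x = O by exact: component_connected.
  apply/seteqP; split=> [|y Oy]; first exact: connected_component_sub.
  by apply: contrapT => nxy; apply: h; exists y.
have [S [S' [tt sse]]] := two_members.
have [s0 Ss0] : S !=set0.
  have Sss : S \in ss by rewrite sse mem_head.
  by have [s0 [_ Ss0]] := component_meets Ox Sss; exists s0.
have Kcomp z : O z -> connected (connected_component O z `|` union ss).
  move=> Oz.
  have -> : connected_component O z `|` union ss =
      \bigcup_(A in [set` ss]) (connected_component O z `|` A).
    apply/seteqP; split=> w.
      move=> [zw|[A As Aw]]; last by exists A => //; right.
      by exists S; [rewrite /= sse mem_head|left].
    by move=> [A As [zw|Aw]]; [left|right; exists A].
  apply: bigcup_connected.
    by exists z => A _; left; exact: connected_component_refl.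
  move=> A As; apply: connectedU_adherent.
  - exact: component_connected.
  - by have [] := solid_ss As.
  - exact: component_meets.
have -> : ~` connected_component O x =
    \bigcup_(z in O `&` ~` connected_component O x)
      (connected_component O z `|` union ss).
  apply/seteqP; split=> w.
    move=> nxw; have [Ow|/contrapT Kw] := pselect (O w).
      by exists w => //; left; exact: connected_component_refl.
    by exists y => //; right.
  move=> [z [Oz nxz] [zw|Kw]]; last by move=> /connected_component_sub.
  move=> xw; apply: nxz; apply: connected_component_trans xw _.
  exact: connected_component_sym.
apply: bigcup_connected; last by move=> z [Oz _]; exact: Kcomp.
by exists s0 => z _; right; exists S => //; rewrite sse mem_head.
Qed.

(** The members of a minimal separating family, together with the finitely many
pieces they cut the space into, form an irreducible partition. *)
Lemma minimal_separation_partition : exists n (A : 'I_n -> set Y),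
  irreducible_partition A /\ (1 < #|closed_index A|)%N.
Proof.
have [us [usP dus usO usall]] := finite_components.
have [S [S' [tt sse]]] := two_members.
have [x0 Ox0] : O !=set0.
  apply: contrapT => h; apply: separates; rewrite -/O.
  suff -> : O = set0 by exact: connected0.
  by rewrite -subset0 => x Ox; apply: h; exists x.
have ss_neq0 A : A \in ss -> A !=set0.
  by move=> /(component_meets Ox0)[y [_ Ay]]; exists y.
have us_open U : U \in us -> open_solid U.
  move=> /usP[x Ox ->]; split; first exact: component_open.
    exact: component_connected.
  exact: coconnected_component.
have us_neq0 U : U \in us -> U !=set0.
  by move=> /usP[x Ox ->]; exists x; exact: connected_component_refl.
pose fam := ss ++ us; pose A (i : 'I_(size fam)) := nth set0 fam i.
have Afam i : A i \in fam by exact: mem_nth.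
have tA : trivIset setT A.
  apply: trivIset_nth; apply/disjoint_family_cat; split => //.
  by rewrite usO setICr.
have closedA i : closed_index A i = (i < size ss)%N.
  apply/asboolP/idP => [cAi|lti]; last first.
    have Ass : A i \in ss by rewrite /A nth_cat lti mem_nth.
    by have [] := solid_ss Ass.
  rewrite ltnNge; apply/negP => lei.
  have Aus : A i \in us.
    by rewrite /A nth_cat ltnNge lei /= mem_nth // ltn_subLR // -size_cat.
  have [oAi _ _] := us_open _ Aus.
  have AT : A i = setT.
    apply: connY; first exact: us_neq0.
      by exists (A i); rewrite ?setTI.
    by exists (A i); rewrite ?setTI.
  have Sss : S \in ss by rewrite sse mem_head.
  have [s0 Ss0] := ss_neq0 _ Sss.
  have : O s0 by rewrite -usO; exists (A i) => //; rewrite AT.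
  by apply; exists S.
have mem_closed i : (i \in closed_index A) = (i < size ss)%N by exact: closedA.
exists (size fam), A; split; last first.
  have lt2 : (1 < size fam)%N by rewrite size_cat sse.
  apply/card_gt1P; exists (Ordinal (ltnW lt2)), (Ordinal lt2).
  by rewrite !mem_closed sse.
split.
  split => //.
  - move=> i; have := Afam i; rewrite mem_cat => /orP[/ss_neq0|/us_neq0] //.
  - move=> i; have := Afam i; rewrite mem_cat => /orP[/solid_ss|/us_open] [? ? ?].
      by split; [right|exact/solidP].
    by split; [left|exact/solidP].
  - by rewrite bigcup_nth union_cat usO setUv.
move=> J Jcl; rewrite -union_enum; apply: minimal.
- rewrite size_map -cardE; apply: leq_trans (proper_card Jcl) _.
  rewrite cardE -(size_map val) -(size_iota 0 (size ss)).
  apply: uniq_leq_size; first by rewrite (map_inj_uniq val_inj) enum_uniq.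
  move=> k /mapP[i]; rewrite mem_enum mem_closed => ? ->.
  by rewrite mem_iota.
- move=> B /mapP[i]; rewrite mem_enum => iJ ->; apply: solid_ss.
  have := fintype.subsetP (proper_sub Jcl) i iJ.
  by rewrite mem_closed => lti; rewrite /A nth_cat lti mem_nth.
- exact: disjoint_family_enum.
Qed.

End MinimalSeparation.

Hypothesis genus0 : has_genus Y 0.

(** A separating family of least size would contradict the bound on the number of
closed members of an irreducible partition. *)
Lemma closed_solids_do_not_separate ss : (forall S, S \in ss -> closed_solid S) ->
  disjoint_family ss -> connected (~` union ss).
Proof.
have [n le_n] := ubnP (size ss); elim: n ss le_n => // n IH ss le_n sol dss.
apply: contrapT => sep.
have [|m [A [irrA]]] := minimal_separation_partition sol dss sep.
  by move=> tt lt_tt; apply: IH; exact: leq_trans lt_tt le_n.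
by rewrite ltnNge; have [_ ->] := genus0.
Qed.

(** Were the complement split by two disjoint open sets [N] and [N'], the compact
remainder of the space would lie in the given open sets, and closed solid
subsets of these that contain it would already separate the space. *)
Lemma open_solids_do_not_separate vs : (forall V, V \in vs -> open_solid V) ->
  disjoint_family vs -> connected (~` union vs).
Proof.
move=> sol dvs; apply: contrapT => sep.
have clD : closed (~` union vs).
  by apply/open_closedC/open_union => V /sol[].
have [N [N' [oN oN' DNN' NN'0 [[a [Da Na]] [b [Db N'b]]]]]] :=
  disconnected_closed clD sep.
pose R := ~` (N `|` N').
have Rvs : R `<=` union vs.
  move=> x nx; apply: contrapT => nvx; apply: nx.
  exact: DNN'.
have hull V : exists L, V \in vs -> [/\ closed_solid L, R `&` V `<=` L & L `<=` V].
  have [Vvs|] := boolP (V \in vs); last by exists set0.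
  have [||L Lp] := @closed_solid_hull V (R `&` V) (sol _ Vvs).
  - have -> : R `&` V = R `&` ~` union [seq W <- vs | W != V].
      apply/seteqP; split=> x [Rx].
        move=> Vx; split => // -[W]; rewrite mem_filter => /andP[/eqP WV Wvs] Wx.
        exact/WV/(disjoint_familyP dvs Wvs Vvs Wx Vx).
      move=> nx; split => //; have [W Wvs Wx] := Rvs _ Rx.
      have [<- //|WV] := eqVneq W V.
      by exfalso; apply: nx; exists W => //; rewrite mem_filter WV.
    apply: closedI; first exact/open_closedC/openU.
    apply/open_closedC/open_union => W; rewrite mem_filter => /andP[_ Wvs].
    by have [] := sol _ Wvs.
  - by move=> x [].
  - by exists L.
have [L Lp] := choice hull.
have cL : connected (~` union (map L vs)).
  apply: closed_solids_do_not_separate.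
    by move=> _ /mapP[V Vvs ->]; have [] := Lp _ Vvs.
  by apply: disjoint_family_map => // V Vvs; have [] := Lp _ Vvs.
have DL : ~` union vs `<=` ~` union (map L vs).
  move=> x nx [_ /mapP[V Vvs ->] LVx]; apply: nx; exists V => //.
  by have [_ _] := Lp _ Vvs; apply.
have LNN' : ~` union (map L vs) `<=` N `|` N'.
  move=> x nx; apply: contrapT => Rx; apply: nx.
  have [V Vvs Vx] := Rvs _ Rx.
  by exists (L V); [exact: map_f|have [_ + _] := Lp _ Vvs; apply].
have [| |] := connected_open_split cL oN oN' LNN'.
- by rewrite -setIA NN'0 setI0.
- by move=> /(_ _ (DL _ Db)) Nb; have : (N `&` N') b by []; rewrite NN'0.
- by move=> /(_ _ (DL _ Da)) N'a; have : (N `&` N') a by []; rewrite NN'0.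
Qed.

(** * Solid-set functions on a space of genus zero *)

Section SolidSetFunction.
Variables (R : realType) (lam : set Y -> R).
Hypothesis ssf_lam : solid_set_function lam.

Notation total := (lam setT).

Lemma closed_solid_bounded K : closed_solid K -> bounded_solid K.
Proof. by left; exact/compact_solidP. Qed.

Lemma open_solid_bounded V : open_solid V -> bounded_solid V.
Proof. by right; exact/bounded_open_solidP. Qed.

Lemma lam_sum_le ss C : (forall S, S \in ss -> closed_solid S) ->
  disjoint_family ss -> closed_solid C -> union ss `<=` C ->
  \sum_(S <- ss) lam S <= lam C.
Proof.
move=> sol dss /compact_solidP sC ssC; rewrite (big_nth set0) big_mkord.
apply: (ssf_superadditive ssf_lam) sC _ _.
- by move=> i; apply/compact_solidP/sol/mem_nth.
- exact: trivIset_nth.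
- by rewrite bigcup_nth.
Qed.

Lemma lam_union vs A : (forall V, V \in vs -> bounded_solid V) ->
  disjoint_family vs -> bounded_solid A -> A = union vs ->
  lam A = \sum_(V <- vs) lam V.
Proof.
move=> sol dvs sA Avs; rewrite (big_nth set0) big_mkord.
apply: (ssf_additive ssf_lam) => //.
- by move=> i; apply/sol/mem_nth.
- exact: trivIset_nth.
- by rewrite bigcup_nth.
Qed.

Lemma lam_closedC K : closed_solid K -> lam (~` K) = total - lam K.
Proof.
move=> sK; rewrite (@lam_union [:: K; ~` K] setT).
- by rewrite !big_cons big_nil addr0 addrAC subrr add0r.
- move=> V; rewrite !inE => /orP[/eqP ->|/eqP ->].
    exact: closed_solid_bounded.
  exact/open_solid_bounded/closed_solidC.
- by rewrite /disjoint_family /= setICr eqxx.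
- exact/closed_solid_bounded/closed_solidT.
- by rewrite union_cons union1 setUv.
Qed.

Lemma lam_openC V : open_solid V -> lam (~` V) = total - lam V.
Proof.
move=> /open_solidC/lam_closedC; rewrite setCK => ->.
by rewrite opprB addrCA subrr addr0.
Qed.

Lemma lam_closed_mono K L : closed_solid K -> closed_solid L -> K `<=` L ->
  lam K <= lam L.
Proof.
move=> sK sL KL; rewrite -(big_seq1 GRing.add K lam).
apply: lam_sum_le => //; last by rewrite union1.
by move=> S; rewrite inE => /eqP ->.
Qed.

Lemma lam_closed_open K V : closed_solid K -> open_solid V -> K `<=` V ->
  lam K <= lam V.
Proof.
move=> /compact_solidP sK /bounded_open_solidP sV KV.
rewrite -lee_fin (ssf_inner ssf_lam sV).
by apply: ereal_sup_ubound; exists K.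
Qed.

Lemma lam_inner_approx V e : open_solid V -> 0 < e ->
  exists K, [/\ closed_solid K, K `<=` V & lam V - e < lam K].
Proof.
move=> /bounded_open_solidP sV e0.
have supV := ssf_inner ssf_lam sV.
have [|_ [K [sK KV] <-]] := ub_ereal_sup_adherent e0 (_ : ereal_sup
    [set (lam K)%:E | K in [set K | compact_solid K /\ K `<=` V]] \is a fin_num).
  by rewrite -supV.
rewrite -supV -EFinB lte_fin => VK.
by exists K; split => //; exact/compact_solidP.
Qed.

(** Outer regularity inside a prescribed neighbourhood [U], by inner regularity
of the complement of [S]. *)
Lemma lam_outer_approx S U e : closed_solid S -> open U -> S `<=` U -> 0 < e ->
  exists V, [/\ open_solid V, S `<=` V, V `<=` U & lam V < lam S + e].
Proof.
move=> sS oU SU e0; have sCS := closed_solidC sS.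
have [K [sK KS lt_K]] := lam_inner_approx sCS e0.
have [||L [sL KL LS]] := @closed_solid_hull (~` S) (K `|` ~` U) sCS.
- by apply: closedU; [case: sK|exact: open_closedC].
- by move=> x [/KS|] //; apply: contra_not => /SU.
exists (~` L); split.
- exact: closed_solidC.
- by move=> x Sx /LS.
- by move=> x nLx; apply: contrapT => nUx; apply: nLx; apply: KL; right.
- have KL' : K `<=` L by move=> x Kx; apply: KL; left.
  have := lam_closed_mono sK sL KL'; rewrite lam_closedC//.
  by move: lt_K; rewrite lam_closedC//; lra.
Qed.

(** The error [e] is halved at each step, and each set is enlarged within an open
set disjoint from a neighbourhood of the later ones. *)
Lemma lam_family_approx ss U e : (forall S, S \in ss -> closed_solid S) ->
  disjoint_family ss -> open U -> union ss `<=` U -> 0 < e ->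
  exists vs, [/\ forall V, V \in vs -> open_solid V, disjoint_family vs,
    union ss `<=` union vs, union vs `<=` U &
    \sum_(V <- vs) lam V <= \sum_(S <- ss) lam S + e].
Proof.
elim: ss U e => [|S ss IH] U e sol dss oU ssU e0.
  by exists [::]; split => //; rewrite ?union_nil // !big_nil add0r ltW.
have sS : closed_solid S by apply: sol; rewrite mem_head.
have sss A : A \in ss -> closed_solid A.
  by move=> Ass; apply: sol; rewrite inE Ass orbT.
have /disjoint_family_cons[Sss0 dss'] := dss.
have [||W [W' [oW oW' SW ssW' WW'0]]] := closed_separation _ _ Sss0.
- by case: sS.
- by apply: closed_union => A /sss[].
have e2 : 0 < e / 2 by rewrite divr_gt0.
have [||V [sV SV VUW leV]] := @lam_outer_approx S (U `&` W) (e / 2) sS _ _ e2.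
- exact: openI.
- by move=> x Sx; split; [apply: ssU; rewrite union_cons; left|exact: SW].
have [||vs [svs dvs ssvs vsUW lev]] := IH (U `&` W') (e / 2) sss dss' _ _ e2.
- exact: openI.
- by move=> x sx; split; [apply: ssU; rewrite union_cons; right|exact: ssW'].
exists (V :: vs); split.
- by move=> A; rewrite inE => /orP[/eqP ->|/svs].
- apply/disjoint_family_cons; split => //; rewrite -subset0 -WW'0.
  by move=> x [/VUW[_ Wx] /vsUW[_ W'x]].
- by rewrite !union_cons; exact: setUSS.
- by rewrite union_cons => x [/VUW[]|/vsUW[]].
- by rewrite !big_cons; move: leV lev; lra.
Qed.

(** ** Tiles *)

Definition region (vs : seq (set Y)) := ~` union vs.

(** A tile stands for a compact connected set with finitely many complementary
components, and is encoded by the list of these components. *)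
Definition tile vs := [/\ disjoint_family vs,
  forall V, V \in vs -> open_solid V & region vs !=set0].

(** The value that additivity imposes on the region: it partitions the space
together with the members of [vs]. *)
Definition weight vs := total - \sum_(V <- vs) lam V.

Definition tiling U ts := [/\ forall t, t \in ts -> tile t,
  disjoint_family (map region ts) & union (map region ts) `<=` U].

Definition tiling_weight ts := \sum_(t <- ts) weight t.

Lemma region_closed vs : tile vs -> closed (region vs).
Proof. by move=> [_ sol _]; apply/open_closedC/open_union => V /sol[]. Qed.

Lemma region_connected vs : tile vs -> connected (region vs).
Proof. by move=> [dvs sol _]; exact: open_solids_do_not_separate. Qed.

Lemma region1 V : region [:: V] = ~` V.
Proof. by rewrite /region union1. Qed.

Lemma weight1 V : weight [:: V] = total - lam V.
Proof. by rewrite /weight big_seq1. Qed.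

Lemma tile1 K : closed_solid K -> K !=set0 -> tile [:: ~` K].
Proof.
move=> sK K0; split => //; last by rewrite region1 setCK.
by move=> V; rewrite inE => /eqP ->; exact: closed_solidC.
Qed.

Lemma tiling_sub U U' ts : U `<=` U' -> tiling U ts -> tiling U' ts.
Proof. by move=> UU' [? ? ?]; split => //; exact: subset_trans UU'. Qed.

Lemma tiling_nil U : tiling U [::].
Proof. by split => //; rewrite union_nil. Qed.

Lemma tiling_cons U t ts : tiling U (t :: ts) <->
  [/\ tile t, region t `<=` U, region t `&` union (map region ts) = set0 &
      tiling U ts].
Proof.
split.
  move=> [tl /disjoint_family_cons[tts dts]].
  rewrite /= union_cons => tsU; split => //.
  - by apply: tl; rewrite mem_head.
  - by move=> x tx; apply: tsU; left.
  - split => //; last by move=> x tx; apply: tsU; right.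
    by move=> t' t'ts; apply: tl; rewrite inE t'ts orbT.
move=> [tt tU tts [tl dts tsU]]; split.
- by move=> t'; rewrite inE => /orP[/eqP ->|/tl].
- exact/disjoint_family_cons.
- by rewrite /= union_cons => x [/tU|/tsU].
Qed.

Lemma tiling_cat U V ts ts' : U `&` V = set0 -> tiling U ts -> tiling V ts' ->
  tiling (U `|` V) (ts ++ ts').
Proof.
move=> UV0 [tl dts tsU] [tl' dts' ts'V]; split.
- by move=> t; rewrite mem_cat => /orP[/tl|/tl'].
- rewrite map_cat; apply/disjoint_family_cat; split => //.
  by rewrite -subset0 -UV0; exact: setISS.
- by rewrite map_cat union_cat; exact: setUSS.
Qed.

Lemma tiling_filter U ts (p : pred (seq (set Y))) :
  tiling U ts -> tiling U [seq t <- ts | p t].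
Proof.
move=> [tl dts tsU]; split.
- by move=> t; rewrite mem_filter => /andP[_ /tl].
- exact: subseq_pairwise (map_subseq _ (filter_subseq _ _)) dts.
- move=> x [A /mapP[t]]; rewrite mem_filter => /andP[_ tts] -> tx.
  by apply: tsU; exists (region t) => //; exact: map_f.
Qed.

Definition inside V ts : seq (seq (set Y)) := [seq t <- ts | `[< region t `<=` V >]].

Lemma tiling_inside U V ts : tiling U ts -> tiling V (inside V ts).
Proof.
move=> /(tiling_filter (fun t => `[< region t `<=` V >])) [tl dts _]; split => //.
move=> x [A /mapP[t]]; rewrite mem_filter => /andP[/asboolP tV _] ->; exact: tV.
Qed.

Lemma sum_mem_disjoint (vs : seq (set Y)) x (c : R) : disjoint_family vs -> union vs x ->
  \sum_(V <- vs | `[< V x >]) c = c.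
Proof.
elim: vs => [|V vs IH]; first by rewrite union_nil.
move=> /disjoint_family_cons[Vvs dvs]; rewrite union_cons big_cons.
have [Vx _|nVx [//|vsx]] := pselect (V x); last first.
  by rewrite asboolF // IH.
rewrite asboolT // big1_seq ?addr0 // => W /andP[/asboolP Wx Wvs].
have : (V `&` union vs) x by split => //; exists W.
by rewrite Vvs.
Qed.

(** Each tile, being connected, lies in just one member of a disjoint family of
open sets that covers it. *)
Lemma sum_inside (f : seq (set Y) -> R) (vs : seq (set Y)) ts : disjoint_family vs ->
  (forall V, V \in vs -> open V) -> tiling (union vs) ts ->
  \sum_(t <- ts) f t = \sum_(V <- vs) \sum_(t <- inside V ts) f t.
Proof.
move=> dvs ovs [tl _ tsvs].
under [RHS]eq_bigr do rewrite big_filter.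
rewrite (exchange_big_dep predT) //=; apply: eq_big_seq => t tts.
have [_ _ [x tx]] := tl _ tts.
have tvs : region t `<=` union vs.
  by move=> y ty; apply: tsvs; exists (region t) => //; exact: map_f.
rewrite -[LHS](sum_mem_disjoint _ dvs (tvs _ tx)) big_seq_cond [RHS]big_seq_cond.
apply: eq_bigl => V; have [Vvs|//] := boolP (V \in vs); rewrite /=.
apply: asbool_equiv_eq; split=> [Vx|]; last exact.
exact: (connected_sub_member (region_connected (tl _ tts)) dvs ovs tvs Vvs tx Vx).
Qed.

(** Cutting along a tile that is not solid: inside each of its complementary
components [V], the cut tile is seen as the solid set [~` V]. The number of
tiles that are not solid decreases. *)
Lemma tiling_induction (P : seq (seq (set Y)) -> Prop) :
  (forall ts, tiling setT ts -> (forall t, t \in ts -> size t = 1%N) -> P ts) ->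
  (forall ts1 t ts2, tiling setT (ts1 ++ t :: ts2) ->
     tile t -> tiling (~` region t) (ts1 ++ ts2) ->
     (forall V, V \in t -> P ([:: V] :: inside V (ts1 ++ ts2))) ->
     P (ts1 ++ t :: ts2)) ->
  forall ts, tiling setT ts -> P ts.
Proof.
move=> Psolid Pcut ts.
pose many (t : seq (set Y)) := size t != 1%N.
have [n] := ubnP (count many ts); elim: n ts => // n IH ts lt_n tlt.
have [/hasP[t tts many_t]|/hasPn solid_ts] := boolP (has many ts); last first.
  by apply: Psolid => // t /solid_ts /negPn /eqP.
case/splitPr: tts lt_n tlt => ts1 ts2 lt_n tlt.
have [tl dts _] := tlt.
have tile_t : tile t by apply: tl; rewrite mem_cat mem_head orbT.
have tlr : tiling (~` region t) (ts1 ++ ts2).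
  move: dts; rewrite map_cat /= => /disjoint_family_move /disjoint_family_cons.
  rewrite -map_cat => -[tr0 dr]; split => //.
    by move=> t' t'r; apply: tl; move: t'r; rewrite !mem_cat inE => /orP[->|->];
      rewrite ?orbT.
  by move=> x rx tx; have : (region t `&` union (map region (ts1 ++ ts2))) x by [];
    rewrite tr0.
apply: Pcut => // V Vt; apply: IH.
  rewrite /= add0n; move: lt_n; rewrite count_cat /= many_t add1n addnS ltnS.
  apply: leq_trans; rewrite ltnS -count_cat /inside count_filter.
  by apply: sub_count => t' /andP[].
have [_ sol [x tx]] := tile_t.
apply/tiling_cons; split => //.
- split => //; first by move=> W; rewrite inE => /eqP ->; exact: sol.
  exists x; rewrite region1 => Vx; apply: tx.
  by exists V.
- rewrite region1 -subset0 => y [nVy [A /mapP[t']]].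
  by rewrite mem_filter => /andP[/asboolP t'V _] -> /t'V.
- exact: tiling_sub (tiling_inside V tlr).
Qed.

Lemma tiling_weight_cut (ts1 : seq (seq (set Y))) t ts2 :
  tiling_weight (ts1 ++ t :: ts2) = weight t + tiling_weight (ts1 ++ ts2).
Proof. by rewrite /tiling_weight !big_cat big_cons /= addrCA. Qed.

Lemma tiling_weight_cons t (ts : seq (seq (set Y))) :
  tiling_weight (t :: ts) = weight t + tiling_weight ts.
Proof. exact: (tiling_weight_cut [::]). Qed.

Lemma tiling_weight_cat (ts ts' : seq (seq (set Y))) :
  tiling_weight (ts ++ ts') = tiling_weight ts + tiling_weight ts'.
Proof. by rewrite /tiling_weight big_cat. Qed.

Lemma tiling_weight_inside t ts : tile t -> tiling (~` region t) ts ->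
  tiling_weight ts = \sum_(V <- t) tiling_weight (inside V ts).
Proof.
move=> [dt sol _]; rewrite /region setCK; apply: sum_inside => //.
by move=> V /sol[].
Qed.

Lemma solid_tiling ts : tiling setT ts -> (forall t, t \in ts -> size t = 1%N) ->
  (forall S, S \in map region ts -> closed_solid S) /\
  tiling_weight ts = \sum_(S <- map region ts) lam S.
Proof.
move=> [tl _ _] sz.
have one t : t \in ts -> exists2 V, open_solid V & t = [:: V].
  move=> tts; have [_ sol _] := tl _ tts.
  move: (sz _ tts) sol; case: t {tts} => [|V []]// _ sol.
  by exists V => //; apply: sol; rewrite mem_head.
split.
  by move=> S /mapP[t /one[V sV ->] ->]; rewrite region1; exact: open_solidC.
rewrite big_map /tiling_weight; apply: eq_big_seq => t /one[V sV ->].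
by rewrite region1 weight1 lam_openC.
Qed.

(** In the inductive step, the inequality inside a complementary component [V]
says that the tiles inside [V] weigh at most [lam V]. *)
Lemma tiling_weight_le ts : tiling setT ts -> tiling_weight ts <= total.
Proof.
move: ts; apply: tiling_induction => [ts tlt sz|ts1 t ts2 _ tile_t tlr IH].
  have [sol ->] := solid_tiling tlt sz; have [_ dts _] := tlt.
  by apply: lam_sum_le => //; exact: closed_solidT.
rewrite tiling_weight_cut (tiling_weight_inside tile_t tlr) /weight.
rewrite -addrA gerDl addrC subr_le0 big_seq [leRHS]big_seq.
apply: ler_sum => V Vt; have := IH V Vt.
by rewrite tiling_weight_cons weight1; lra.
Qed.

(** ** The content of an open set *)

Definition content U := sup [set tiling_weight ts | ts in tiling U].

Lemma tiling_weight_has_sup U : has_sup [set tiling_weight ts | ts in tiling U].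
Proof.
split; first by exists (tiling_weight [::]); exists [::] => //; exact: tiling_nil.
exists total => _ [ts tlt <-]; apply: tiling_weight_le.
exact: tiling_sub tlt.
Qed.

Lemma content_ge U ts : tiling U ts -> tiling_weight ts <= content U.
Proof.
move=> tlt; apply: sup_upper_bound; first exact: tiling_weight_has_sup.
by exists ts.
Qed.

Lemma content_le U c : (forall ts, tiling U ts -> tiling_weight ts <= c) ->
  content U <= c.
Proof.
move=> h; apply: ge_sup; first by have [] := tiling_weight_has_sup U.
by move=> _ [ts tlt <-]; exact: h.
Qed.

Lemma content_approx U e : 0 < e ->
  exists2 ts, tiling U ts & content U - e < tiling_weight ts.
Proof.
move=> e0; have [_ [ts tlt <-]] := sup_adherent e0 (tiling_weight_has_sup U).
by exists ts.
Qed.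

Lemma content_ge0 U : 0 <= content U.
Proof.
by have := content_ge (tiling_nil U); rewrite /tiling_weight big_nil.
Qed.

Lemma content_mono U V : U `<=` V -> content U <= content V.
Proof.
by move=> UV; apply: content_le => ts /(tiling_sub UV); exact: content_ge.
Qed.

Lemma content_superadditive U V : U `&` V = set0 ->
  content U + content V <= content (U `|` V).
Proof.
move=> UV0; rewrite -lerBrDr; apply: content_le => ts tlt.
rewrite lerBrDr addrC -lerBrDr; apply: content_le => ts' tlt'.
by rewrite lerBrDr addrC -tiling_weight_cat; exact/content_ge/tiling_cat.
Qed.

Lemma content_sum_le us : disjoint_family us ->
  \sum_(U <- us) content U <= content (union us).
Proof.
elim: us => [|U us IH]; first by rewrite big_nil content_ge0.
move=> /disjoint_family_cons[Uus0 dus]; rewrite big_cons union_cons.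
by apply: le_trans (content_superadditive Uus0); rewrite lerD2l IH.
Qed.

(** Once solid tiles are slightly enlarged to open solid sets, what is left is a
single tile of almost complementary weight. In the inductive step, the sets
obtained inside the complementary components of the cut tile are disjoint, and
their contents add up. *)
Lemma content_complement_ge ts : tiling setT ts ->
  total - tiling_weight ts <= content (~` union (map region ts)).
Proof.
move: ts; apply: tiling_induction => [ts tlt sz|ts1 t ts2 tlt tile_t tlr IH].
  have [sol ->] := solid_tiling tlt sz; have [_ dts _] := tlt.
  apply/ler_addgt0Pr => e e0; rewrite -lerBlDr.
  have [vs [svs dvs ssvs _ lev]] :=
    lam_family_approx sol dts openT (@subsetT _ _) e0.
  apply: le_trans (_ : weight vs <= _).
    by rewrite /weight; move: lev; lra.
  have [vs0|vsT] := pselect (region vs !=set0); last first.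
    (* The enlarged sets cover the space and have at least the total mass. *)
    apply: le_trans (content_ge0 _); rewrite /weight subr_le0.
    rewrite -(@lam_union vs setT) //.
    - by move=> V /svs; exact: open_solid_bounded.
    - exact/closed_solid_bounded/closed_solidT.
    - apply/esym; rewrite -subTset => x _; apply: contrapT => nx.
      by apply: vsT; exists x.
  have : tiling (~` union (map region ts)) [:: vs].
    apply/tiling_cons; split => //; last exact: tiling_nil.
      by move=> x nx /ssvs.
    by rewrite union_nil setI0.
  by move=> /content_ge; rewrite tiling_weight_cons /tiling_weight big_nil addr0.
rewrite tiling_weight_cut (tiling_weight_inside tile_t tlr) /weight.
have [dt sol _] := tile_t.
pose rest V := ~` union (map region ([:: V] :: inside V (ts1 ++ ts2))).
have restV V : rest V `<=` V.
  move=> x nx; apply: contrapT => nVx; apply: nx.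
  by rewrite /= union_cons region1; left.
apply: (@le_trans _ _ (content (union (map rest t)))); last first.
  apply: content_mono => x [A /mapP[V Vt ->] Wx].
  rewrite map_cat /= => -[B].
  rewrite mem_cat in_cons orbCA => /predU1P[->|].
    by apply; exists V => //; exact: restV.
  rewrite -mem_cat -map_cat => /mapP[t' t'r ->] t'x.
  have xV := restV _ _ Wx; apply: Wx.
  have [tl _ sub] := tlr; rewrite union_cons; right.
  exists (region t') => //; apply: map_f; rewrite mem_filter t'r andbT.
  apply/asboolP; have := sub; rewrite /region setCK => sub'.
  have t't : region t' `<=` union t.
    by move=> y t'y; apply: sub'; exists (region t') => //; exact: map_f.
  apply: (connected_sub_member _ dt _ t't Vt t'x xV).
    exact/region_connected/tl.
  by move=> W /sol[].
apply: le_trans (content_sum_le _); last first.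
  by apply: disjoint_family_map => // V _; exact: restV.
rewrite big_map; apply: (@le_trans _ _
    (\sum_(V <- t) (lam V - tiling_weight (inside V (ts1 ++ ts2))))).
  by rewrite sumrB; lra.
rewrite big_seq [leRHS]big_seq.
apply: ler_sum => V Vt; apply: le_trans (IH V Vt).
by rewrite tiling_weight_cons weight1; lra.
Qed.

(** ** Covering compact sets by tilings *)

(** Only finitely many complementary components of [K] leave [U]; they become the
complementary components of the tile. *)
Lemma fill_holes K U : closed K -> connected K -> K !=set0 -> open U ->
  K `<=` U -> exists t, [/\ tile t, K `<=` region t, region t `<=` U &
    forall V, V \in t -> exists x, V = connected_component (~` K) x].
Proof.
move=> clK cK [k Kk] oU KU.
have [|us [usP dus nUus]] := finitely_many_components lconnY
    (closed_openC clK) (closed_compactY (open_closedC oU)); first exact: subsetC.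
have Kus : K `<=` region us.
  by move=> x Kx [V /usP[y _ ->]] /connected_component_sub.
exists us; split => //.
- split => //; last by exists k; exact: Kus.
  move=> V /usP[x nKx ->]; split; first exact/component_open/closed_openC.
    exact: component_connected.
  by apply: component_coconnected => //; exists k.
- by move=> x nus; apply: contrapT => /nUus.
- by move=> V /usP[x _ ->]; exists x.
Qed.

(** Merge [K] with the tiles that it meets and fill the holes: a remaining tile
either survives or has been swallowed. *)
Lemma tiling_absorb U ts K : open U -> tiling U ts -> closed K -> connected K ->
  K `<=` U -> exists2 ts', tiling U ts' &
    K `|` union (map region ts) `<=` union (map region ts').
Proof.
move=> oU tlt clK cK KU; have [tl dts tsU] := tlt.
have [[k Kk]|K0] := pselect (K !=set0); last first.
  by exists ts => // x [Kx|//]; exfalso; apply: K0; exists x.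
pose met := [seq t <- ts | `[< region t `&` K !=set0 >]].
have metP t : t \in met -> tile t /\ region t `&` K !=set0.
  by rewrite mem_filter => /andP[/asboolP ? /tl].
pose N := K `|` union (map region met).
have NE : N = \bigcup_(A in [set` K :: map region met]) (K `|` A).
  apply/seteqP; split=> x.
    move=> [Kx|[A Am Ax]]; first by exists K; [rewrite /= mem_head|left].
    by exists A; [rewrite /= inE Am orbT|right].
  move=> [A /=]; rewrite inE => /orP[/eqP ->|Am] [Kx|Ax]; try by left.
  by right; exists A.
have cN : connected N.
  rewrite NE; apply: bigcup_connected; first by exists k => A _; left.
  move=> A /=; rewrite inE => /orP[/eqP ->|]; first by rewrite setUid.
  move=> /mapP[t /metP[tt [x [tx Kx]]] ->]; apply: connectedU => //.
    by exists x.
  exact: region_connected.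
have clN : closed N.
  apply: closedU => //; apply: closed_union => _ /mapP[t /metP[tt _] ->].
  exact: region_closed.
have NU : N `<=` U.
  have [_ _ mU] := tiling_filter (fun t => `[< region t `&` K !=set0 >]) tlt.
  by move=> x [/KU|/mU].
have [|t0 [tt0 Nt0 t0U t0N]] := fill_holes clN cN _ oU NU.
  by exists k; left.
pose apart := fun t => region t `&` region t0 == set0.
exists (t0 :: [seq t <- ts | apart t]).
  apply/tiling_cons; split => //; last exact: tiling_filter.
  rewrite -subset0 => x [t0x [A /mapP[t]]].
  by rewrite mem_filter => /andP[/eqP tt00 _] -> tx; rewrite -tt00.
rewrite /= union_cons => x [Kx|[A /mapP[t tts ->] tx]].
  by left; apply: Nt0; left.
have [at0|] := boolP (apart t).
  right; exists (region t) => //; apply: map_f; by rewrite mem_filter at0.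
move=> /set0P[y [ty t0y]]; left.
have [tK|ntK] := pselect (region t `&` K !=set0).
  apply: Nt0; right; exists (region t) => //; apply: map_f.
  by rewrite mem_filter tts andbT; apply/asboolP.
have tN : region t `<=` ~` N.
  move=> z tz [Kz|[B /mapP[t' t'm ->] t'z]]; first by apply: ntK; exists z.
  have [_ meets] := metP _ t'm; apply: ntK.
  suff -> : region t = region t' by [].
  apply: (disjoint_familyP dts _ _ tz t'z); apply: map_f => //.
  by move: t'm; rewrite mem_filter => /andP[].
move=> [V Vt0 Vx]; apply: t0y; exists V => //.
have [z VE] := t0N _ Vt0.
suff tV : region t `<=` V by exact: tV.
rewrite VE; apply: component_absorbs => //; first exact/region_connected/tl.
by exists x; rewrite -VE.
Qed.

(** Cover by finitely many closures of connected open sets and absorb them one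
after the other. *)
Lemma tiling_cover U F : open U -> closed F -> F `<=` U ->
  exists2 ts, tiling U ts & F `<=` union (map region ts).
Proof.
move=> oU clF FU.
have [ks [ksP Fks]] : exists ks, (forall K, K \in ks ->
    [/\ closed K, connected K & K `<=` U]) /\ F `<=` union ks.
  pose P F := exists ks, (forall K, K \in ks ->
    [/\ closed K, connected K & K `<=` U]) /\ F `<=` union ks.
  apply: (@compact_induction _ P F) => [|A B|A B AB||x /FU Ux].
  - by exists [::]; split => //; rewrite union_nil.
  - move=> [s [sP As]] [t [tP Bt]]; exists (s ++ t); split.
      by move=> K; rewrite mem_cat => /orP[/sP|/tP].
    by rewrite union_cat; exact: setUSS.
  - by move=> [s [sP Bs]]; exists s; split => //; exact: subset_trans Bs.
  - exact: closed_compactY.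
  - have [W [oW Wx cW WU]] := connected_shrink oU Ux.
    exists W; first exact: open_nbhs_nbhs.
    exists [:: closure W]; split; last by rewrite union1; exact: subset_closure.
    move=> K; rewrite inE => /eqP ->; split => //; first exact: closed_closure.
    exact: connected_closure.
suff [ts tlt ksts] : exists2 ts, tiling U ts & union ks `<=` union (map region ts).
  by exists ts => //; exact: subset_trans ksts.
elim: ks ksP {Fks} => [|K ks IH] ksP.
  by exists [::]; [exact: tiling_nil|rewrite union_nil].
have [|ts tlt ksts] := IH; first by move=> L Lks; apply: ksP; rewrite inE Lks orbT.
have [clK cK KU] := ksP K (mem_head _ _).
have [ts' tlt' sub] := tiling_absorb oU tlt clK cK KU.
exists ts' => //; rewrite union_cons; apply: subset_trans sub.
exact: setUS.
Qed.

(** ** The topological measure on the compact space *)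

Lemma lam_set0 : lam set0 = 0.
Proof. by rewrite -setCT lam_closedC ?subrr //; exact: closed_solidT. Qed.

(** A tile inside the union lies in one of the two sets. *)
Lemma content_openU U V : open U -> open V -> U `&` V = set0 ->
  content (U `|` V) = content U + content V.
Proof.
move=> oU oV UV0; apply/eqP; rewrite eq_le content_superadditive // andbT.
apply: content_le => ts tlt.
have UVE : U `|` V = union [:: U; V] by rewrite union_cons union1.
rewrite UVE in tlt.
rewrite /tiling_weight (@sum_inside weight [:: U; V]) //.
- rewrite !big_cons big_nil addr0; apply: lerD; apply: content_ge.
    exact: tiling_inside tlt.
  exact: tiling_inside tlt.
- by rewrite /disjoint_family /= UV0 eqxx.
- by move=> W; rewrite !inE => /orP[/eqP ->|/eqP ->].
Qed.

(** Tile a neighbourhood of [~` V] inside [U]: the content of [V] is at least the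
remaining mass. *)
Lemma content_cover U V : open U -> open V -> U `|` V = setT ->
  total <= content U + content V.
Proof.
move=> oU oV UVT.
have [|ts tlt nVts] := tiling_cover oU (open_closedC oV).
  by move=> x nVx; have : (U `|` V) x by [rewrite UVT]; case.
have := content_ge tlt.
have /content_complement_ge : tiling setT ts by exact: tiling_sub tlt.
have /content_mono : ~` union (map region ts) `<=` V.
  by move=> x nx; apply: contrapT => /nVts.
by lra.
Qed.

Lemma content_tiling_complement ts : tiling setT ts ->
  content (~` union (map region ts)) <= total - tiling_weight ts.
Proof.
move=> [tl dts _]; apply: content_le => ts' tlt'.
rewrite lerBrDr -tiling_weight_cat; apply: tiling_weight_le.
apply: tiling_sub (tiling_cat (setICl _) tlt' _); first by [].
by split.
Qed.

Lemma content_open_solid V : open_solid V -> content V = lam V.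
Proof.
move=> sV; apply/eqP; rewrite eq_le; apply/andP; split.
  apply: content_le => ts tlt.
  have [nV0|V_T] := pselect (~` V !=set0); last first.
    have -> : V = setT.
      by rewrite -subTset => x _; apply: contrapT => nVx; apply: V_T; exists x.
    by apply: tiling_weight_le; exact: tiling_sub tlt.
  have /tiling_weight_le : tiling setT ([:: V] :: ts).
    apply/tiling_cons; split => //; last exact: tiling_sub tlt.
      by rewrite -[V]setCK; apply: tile1 => //; exact: open_solidC.
    rewrite region1 -subset0 => x [nVx tx].
    by have [_ _ /(_ _ tx)] := tlt.
  by rewrite tiling_weight_cons weight1; lra.
apply/ler_addgt0Pr => e e0; rewrite -lerBlDr.
have [K [sK KV /ltW/le_trans]] := lam_inner_approx sV e0; apply.
have [K0|K0] := pselect (K !=set0); last first.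
  have -> : K = set0 by rewrite -subset0 => x Kx; apply: K0; exists x.
  by rewrite lam_set0 content_ge0.
have : tiling V [:: [:: ~` K]].
  apply/tiling_cons; split; [exact: tile1| | |exact: tiling_nil].
    by rewrite region1 setCK.
  by rewrite union_nil setI0.
move=> /content_ge; rewrite tiling_weight_cons weight1 lam_closedC //.
by rewrite /tiling_weight big_nil; lra.
Qed.

Definition closed_content K := total - content (~` K).

Lemma closed_content_solid K : closed_solid K -> closed_content K = lam K.
Proof.
move=> sK; rewrite /closed_content content_open_solid ?lam_closedC //.
  by rewrite opprB addrCA subrr addr0.
exact: closed_solidC.
Qed.

Lemma closed_content_le K U : closed K -> open U -> K `<=` U ->
  closed_content K <= content U.
Proof.
move=> clK oU KU; rewrite lerBlDr; apply: content_cover => //.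
  exact: closed_openC.
rewrite -subTset => x _.
by have [Kx|nKx] := pselect (K x); [left; exact: KU|right].
Qed.

(** The union of a nearly optimal tiling of [U] is closed, and together with any
tiling of its complement it weighs at most the total mass. *)
Lemma content_inner_approx U e : open U -> 0 < e ->
  exists K, [/\ closed K, K `<=` U & content U - e < closed_content K].
Proof.
move=> oU e0; have [ts tlt lt_ts] := content_approx U e0.
have [tl _ tsU] := tlt.
exists (union (map region ts)); split => //.
  by apply: closed_union => _ /mapP[t tts ->]; exact/region_closed/tl.
have /content_tiling_complement : tiling setT ts by exact: tiling_sub tlt.
by rewrite /closed_content; move: lt_ts; lra.
Qed.

Lemma closed_content_outer_approx K e : closed K -> 0 < e ->
  exists U, [/\ open U, K `<=` U & content U < closed_content K + e].
Proof.
move=> clK e0.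
have [L [clL LnK lt_L]] := content_inner_approx (closed_openC clK) e0.
exists (~` L); split; first exact: closed_openC.
  by move=> x Kx /LnK.
by move: lt_L; rewrite /closed_content; lra.
Qed.

(** By outer regularity this reduces to disjoint open sets. *)
Lemma closed_contentU K L : closed K -> closed L -> K `&` L = set0 ->
  closed_content (K `|` L) = closed_content K + closed_content L.
Proof.
move=> clK clL KL0; have clKL := closedU clK clL.
have [U [V [oU oV KU LV UV0]]] := closed_separation clK clL KL0.
apply/eqP; rewrite eq_le; apply/andP; split; apply/ler_addgt0Pr => e e0.
  have e2 : 0 < e / 2 by rewrite divr_gt0.
  have [U' [oU' KU' lt_U]] := closed_content_outer_approx clK e2.
  have [V' [oV' LV' lt_V]] := closed_content_outer_approx clL e2.
  have /closed_content_le : K `|` L `<=` (U `&` U') `|` (V `&` V').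
    by move=> x [Kx|Lx]; [left; split; [exact: KU|exact: KU']|
      right; split; [exact: LV|exact: LV']].
  move=> /(_ clKL (openU (openI oU oU') (openI oV oV'))).
  rewrite content_openU; [|exact: openI|exact: openI|]; last first.
    by rewrite setIACA UV0 set0I.
  have := content_mono (@subIsetr _ U U'); have := content_mono (@subIsetr _ V V').
  by move: lt_U lt_V; lra.
have [W [oW KLW lt_W]] := closed_content_outer_approx clKL e0.
have KWU : closed_content K <= content (W `&` U).
  apply: closed_content_le => //; first exact: openI.
  by move=> x Kx; split; [apply: KLW; left|exact: KU].
have LWV : closed_content L <= content (W `&` V).
  apply: closed_content_le => //; first exact: openI.
  by move=> x Lx; split; [apply: KLW; right|exact: LV].
have /content_superadditive : (W `&` U) `&` (W `&` V) = set0.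
  by rewrite setIACA UV0 setI0.
have /content_mono : (W `&` U) `|` (W `&` V) `<=` W by move=> x [[]|[]].
by move: KWU LWV lt_W; lra.
Qed.

(** On a clopen set the two formulas agree: see [extension_closed]. *)
Definition extension A := if `[< open A >] then content A else closed_content A.

Lemma extension_open U : open U -> extension U = content U.
Proof. by move=> oU; rewrite /extension asboolT. Qed.

Lemma content_setT : content setT = total.
Proof. by rewrite content_open_solid //; exact: open_solidT. Qed.

Lemma content_set0 : content set0 = 0.
Proof.
rewrite content_open_solid ?lam_set0 // -setCT.
exact/closed_solidC/closed_solidT.
Qed.

Lemma extension_closed K : closed K -> extension K = closed_content K.
Proof.
move=> clK; rewrite /extension; case: asboolP => // oK.
have [K0|K0] := pselect (K !=set0).
  have -> : K = setT by apply: connY => //; exists K; rewrite ?setTI.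
  by rewrite /closed_content setCT content_set0 subr0 content_setT.
have -> : K = set0 by rewrite -subset0 => x Kx; apply: K0; exists x.
by rewrite /closed_content setC0 content_setT subrr content_set0.
Qed.

(** When one of the sets is open and the other closed, the identity is that for
the complement of the union and one of the two pieces. *)
Lemma extension_additive A B : closed A \/ open A -> closed B \/ open B ->
  closed (A `|` B) \/ open (A `|` B) -> A `&` B = set0 ->
  extension (A `|` B) = extension A + extension B.
Proof.
have mixed K U : closed K -> open U -> closed (K `|` U) \/ open (K `|` U) ->
    K `&` U = set0 -> extension (K `|` U) = extension K + extension U.
  move=> clK oU clop KU0; rewrite (extension_closed clK) (extension_open oU).
  have KCU : K `<=` ~` U by apply/disjoints_subset.
  case: clop => [clKU|oKU].
    have := @content_openU (~` (K `|` U)) U (closed_openC clKU) oU.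
    have -> : ~` (K `|` U) `|` U = ~` K.
      rewrite setCU; apply/seteqP; split=> x.
        by move=> [[]|Ux] // /KCU.
      by move=> nKx; have [?|?] := pselect (U x); [right|left].
    rewrite (extension_closed clKU) /closed_content => -> //; first by lra.
    by rewrite -subset0 => x [nKU Ux]; apply: nKU; right.
  have := @closed_contentU K (~` (K `|` U)) clK (open_closedC oKU).
  have -> : K `|` ~` (K `|` U) = ~` U.
    rewrite setCU; apply/seteqP; split=> x.
      by move=> [/KCU|[]].
    by move=> nUx; have [?|?] := pselect (K x); [left|right].
  have K0 : K `&` ~` (K `|` U) = set0.
    by rewrite -subset0 => x [Kx nKU]; apply: nKU; left.
  by rewrite (extension_open oKU) /closed_content !setCK => /(_ K0); lra.
move=> [clA|oA] [clB|oB] clop AB0.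
- have clAB := closedU clA clB.
  by rewrite !extension_closed // closed_contentU.
- exact: mixed.
- by rewrite setUC addrC; apply: mixed => //; rewrite 1?setUC 1?setIC.
- by rewrite !extension_open ?content_openU //; exact: openU.
Qed.

End SolidSetFunction.
End CompactSpace.

(** * The one-point compactification *)

Section OnePointCompactification.
Variable X : topologicalType.
Hypotheses (hausX : hausdorff_space X) (noncompactX : ~ compact [set: X]).
Hypotheses (lcompactX : locally_compact [set: X]) (connX : connected [set: X]).
Hypothesis lconnX : locally_connected X.

Notation Xhat := (one_point_compactification X).
Notation hat A := ((Some : X -> Xhat) @` A).
Notation infinity := (None : Xhat).
Notation trace B := ((Some : X -> Xhat) @^-1` B).
Implicit Types A K U V : set X.

Lemma hatP A x : hat A (Some x) <-> A x.
Proof. by split=> [[y Ay [<-]]|Ax]; [|exists x]. Qed.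

Lemma hat_infinity A : ~ hat A infinity.
Proof. by case. Qed.

Lemma trace_hat A : trace (hat A) = A.
Proof. by apply/seteqP; split => x /hatP. Qed.

Lemma hat_trace (B : set Xhat) : ~ B infinity -> hat (trace B) = B.
Proof.
move=> nB; apply/seteqP; split=> [_ [x Bx <-]//|[x|] Bx]; last by [].
by exists x.
Qed.

Lemma hatS A B : hat A `<=` hat B <-> A `<=` B.
Proof.
split=> AB; last exact: image_subset.
by move=> x /hatP/AB/hatP.
Qed.

Lemma hatI A B : hat (A `&` B) = hat A `&` hat B.
Proof.
apply/seteqP; split=> [_ [x [Ax Bx] <-]|_ [[x Ax <-] [y By [yx]]]].
  by split; exists x.
by exists x => //; split => //; rewrite -yx.
Qed.

Lemma hat_set0 : hat (@set0 X) = set0.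
Proof. exact: image_set0. Qed.

Lemma hat_disjoint A B : A `&` B = set0 -> hat A `&` hat B = set0.
Proof. by move=> AB0; rewrite -hatI AB0 hat_set0. Qed.

Lemma hat_nbhs (x : X) U : nbhs x U -> nbhs (Some x : Xhat) (hat U).
Proof. exact: one_point_compactification_some_nbhs. Qed.

Lemma trace_open (B : set Xhat) : open B -> open (trace B).
Proof.
by move/continuousP : (@one_point_compactification_some_continuous X); apply.
Qed.

Lemma trace_closed (B : set Xhat) : closed B -> closed (trace B).
Proof.
by move=> cB; rewrite -openC preimage_setC; exact/trace_open/closed_openC.
Qed.

Lemma hat_open A : open (hat A) <-> open A.
Proof.
split; last exact: one_point_compactification_open_some.
by move=> /trace_open; rewrite trace_hat.
Qed.

Lemma hat_compact A : compact A -> compact (hat A).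
Proof.
move=> cA; apply: continuous_compact => //.
exact/continuous_subspaceT/one_point_compactification_some_continuous.
Qed.

(** A filter on [X] pushed forward to the compactification clusters at a point of
[B], which is not infinity; it clusters at the same point of [X] because [Some]
is an open embedding. *)
Lemma trace_compact (B : set Xhat) : compact B -> ~ B infinity ->
  compact (trace B).
Proof.
move=> cB nB F PF FB.
have [|y [By clF]] := cB (Some @ F) _.
  by rewrite /= nbhs_simpl.
case: y By clF => [x|] By clF; last by [].
exists x; split => // S W FS xW.
have [|_ [[z Sz <-] [w Ww [wz]]]] := clF (hat S) (hat W) _
  (hat_nbhs xW).
  by rewrite /= nbhs_simpl; apply: filterS FS => z Sz; exists z.
by exists z; split => //; rewrite -wz.
Qed.

Lemma hat_connected A : connected (hat A) <-> connected A.
Proof.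
split=> cA; last first.
  apply: connected_continuous_connected => //.
  exact/continuous_subspaceT/one_point_compactification_some_continuous.
apply: connected_open_splitP => U V oU oV AUV AUV0.
have [||||AU|AV] := @connected_open_split _ (hat A) (hat U) (hat V) cA.
- exact/hat_open.
- exact/hat_open.
- by move=> _ [x /AUV[Ux|Vx] <-]; [left|right]; exists x.
- by rewrite -!hatI AUV0 hat_set0.
- by left; exact/hatS.
- by right; exact/hatS.
Qed.

Lemma compact_neighborhood (x : X) : exists K, [/\ nbhs x K, compact K & closed K].
Proof.
have [K xK [cK clK]] := lcompactX (I : [set: X] x).
by exists K; split => //; move: xK; rewrite withinET.
Qed.

Lemma infinity_nbhs (K : set X) : compact K -> closed K ->
  nbhs infinity (hat (~` K) `|` [set infinity]).
Proof. by move=> cK clK; exists K. Qed.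

Lemma hausdorff_opc : hausdorff_space Xhat.
Proof.
have separate (x : X) : exists U U' : set Xhat,
    [/\ nbhs (Some x : Xhat) U, nbhs infinity U' & U `&` U' = set0].
  have [K [xK cK clK]] := compact_neighborhood x.
  exists (hat K), (hat (~` K) `|` [set infinity]); split.
  - exact: hat_nbhs.
  - exact: infinity_nbhs.
  - by rewrite -subset0 => _ [[z Kz <-] [[w nKw [wz]]|//]]; apply: nKw; rewrite wz.
move=> [x|] [y|] clxy //.
- congr Some; apply: hausX => U V xU yV.
  have [_ [[z Uz <-] [w Vw [wz]]]] := clxy _ _
    (hat_nbhs xU)
    (hat_nbhs yV).
  by exists z; split => //; rewrite -wz.
- have [U [U' [xU iU' UU'0]]] := separate x.
  by have [z] := clxy _ _ xU iU'; rewrite UU'0.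
- have [U [U' [yU iU' UU'0]]] := separate y.
  by have [z] := clxy _ _ iU' yU; rewrite setIC UU'0.
Qed.

Let compact_opc := @one_point_compactification_compact X.

(** Boundedness is a statement about the point at infinity; in this form it can be
handled inside the compactification. *)
Lemma relatively_compactP A :
  relatively_compact A <-> ~ closure (hat A) infinity.
Proof.
split=> [cA clA|nA].
  have cl : closed (hat (closure A)).
    exact/(compact_closed hausdorff_opc)/hat_compact.
  have : hat (closure A) infinity.
    rewrite [hat (closure A)](closure_id _).1 //.
    by move: clA; apply: closureS; apply/hatS; exact: subset_closure.
  exact: hat_infinity.
have cK : compact (trace (closure (hat A))).
  apply: trace_compact => //; apply: closed_compactY => //.
  exact: closed_closure.
apply: subclosed_compact cK _; first exact: closed_closure.
have clT := trace_closed (@closed_closure _ (hat A)).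
rewrite [X in _ `<=` X](closure_id _).1 //.
apply: closureS => x Ax; apply: subset_closure; exact/hatP.
Qed.

Lemma infinity_adherent : closure (hat [set: X]) infinity.
Proof.
apply: contrapT => /relatively_compactP; rewrite /relatively_compact.
by rewrite -(closure_id _).1 //; exact: closedT.
Qed.

Lemma connected_opc : connected [set: Xhat].
Proof.
apply: connected_between ((hat_connected _).2 connX) _ _ => // -[x|] _.
  by apply: subset_closure; exact/hatP.
exact: infinity_adherent.
Qed.

(** Near the point at infinity a base of connected neighbourhoods is given by
the unions of the unbounded components of complements of compact sets: only
finitely many components leave a larger compact set. *)
Lemma locally_connected_opc : locally_connected Xhat.
Proof.
move=> [x|] U; rewrite /nbhs /=.
  rewrite nbhs_simpl => xU; have [V [oV Vx VU cV]] := lconnX xU.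
  exists (hat V); split; [exact/hat_open|exact/hatP| |exact/hat_connected].
  by move=> _ [y Vy <-]; exact: VU.
move=> [K [cK clK] KU].
have [[k Kk]|K0] := pselect (K !=set0); last first.
  exists setT; split => //; [exact: openT| |exact: connected_opc].
  move=> [x|] _; apply: KU; last by right.
  by left; exists x => // Kx; apply: K0; exists x.
have openC : open (~` K) by exact: closed_openC.
have cl_infty : closed [set infinity].
  exact/accessible_closed_set1/hausdorff_accessible/hausdorff_opc.
have cl_hatK : closed (hat K) by exact/(compact_closed hausdorff_opc)/hat_compact.
have [|N [N' [oN oN' iN KN' NN'0]]] :=
    closed_separation compact_opc hausdorff_opc cl_infty cl_hatK.
  by rewrite -subset0 => y [->] /hat_infinity.
pose F := trace (~` (N `|` N')).
have cF : compact F.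
  apply: trace_compact; last by apply; left; exact: iN.
  by apply: closed_compactY => //; exact/open_closedC/openU.
have FnK : F `<=` ~` K by move=> x nNx Kx; apply: nNx; right; apply: KN'; exists x.
have [us [usP _ Fus]] := finitely_many_components lconnX openC cF FnK.
pose unbounded := [set x | ~ K x /\
  closure (hat (connected_component (~` K) x)) infinity].
pose W := hat unbounded `|` [set infinity].
have unbounded_component x y : unbounded x ->
    connected_component (~` K) x y -> unbounded y.
  move=> [nKx clx] xy; split; first exact: connected_component_sub xy.
  by rewrite -(same_connected_component xy).
pose bounded_us := [seq closure (hat u) | u <- us & ~~ `[< closure (hat u) infinity >]].
have W_near_infinity : N `&` ~` union bounded_us `<=` W.
  move=> [x|] [Nx nbx]; last by right.
  left; exists x => //.
  have nKx : ~ K x.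
    move=> Kx; have : (N `&` N') (Some x) by split => //; apply: KN'; exists x.
    by rewrite NN'0.
  split => //; apply: contrapT => bx.
  have [z [xz Fz]] : connected_component (~` K) x `&` F !=set0.
    apply: contrapT => h.
    have [||CN|CN'] := connected_open_split (@component_connected _ (~` K) x)
        (trace_open oN) (trace_open oN').
    - by move=> z xz; apply: contrapT => nz; apply: h; exists z; split.
    - by rewrite -setIA -preimage_setI NN'0 preimage_set0 setI0.
    - have [z [clz Kz]] := closure_component_meets lconnX connX clK
        (ex_intro _ k Kk) nKx.
      have [|w [/CN Nw N'w]] := clz (trace N') _.
        apply: open_nbhs_nbhs; split; first exact: trace_open.
        by apply: KN'; exists z.
      by have : (N `&` N') (Some w) by []; rewrite NN'0.
    - have N'x : N' (Some x) by exact/CN'/connected_component_refl.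
      by have : (N `&` N') (Some x) by []; rewrite NN'0.
  have [u uus uz] := Fus _ Fz.
  have [y nKy uy] := usP _ uus.
  have ux : u = connected_component (~` K) x.
    rewrite uy (same_connected_component xz); apply: same_connected_component.
    by rewrite -uy.
  apply: nbx; exists (closure (hat u)).
    by apply: map_f; rewrite mem_filter uus andbT; apply/asboolPn; rewrite ux.
  apply: subset_closure; apply/hatP; rewrite ux.
  exact: connected_component_refl.
exists W; split.
- rewrite openE => -[x|]; rewrite /interior.
    move=> [/hatP ux|//].
    apply: (@filterS _ _ _ (hat (connected_component (~` K) x))).
      by move=> _ [y xy <-]; left; apply/hatP; exact: unbounded_component xy.
    apply: open_nbhs_nbhs; split; first exact/hat_open/component_open.
    by apply/hatP; apply: connected_component_refl; case: ux.
  move=> _; apply: filterS W_near_infinity _.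
  apply: open_nbhs_nbhs; split.
    apply: openI => //; apply: closed_openC; apply: closed_union.
    by move=> _ /mapP[u _ ->]; exact: closed_closure.
  split; first exact: iN.
  by move=> [_ /mapP[u + ->]]; rewrite mem_filter => /andP[/asboolPn].
- by right.
- move=> [x|] Wx; apply: KU; last by right.
  by left; apply/hatP; case: Wx => // /hatP[].
- have -> : W = \bigcup_(o in [set o | if o is Some x then unbounded x else True])
      ((if o is Some x then hat (connected_component (~` K) x) else set0)
       `|` [set infinity]).
    apply/seteqP; split=> y.
      move=> [[x ux <-]|->]; last by exists None => //; right.
      by exists (Some x) => //; left; apply/hatP; apply: connected_component_refl;
        case: ux.
    move=> [[x|] ux [|->]] //; try by right.
    by move=> [z xz <-]; left; apply/hatP; exact: unbounded_component xz.
  apply: bigcup_connected; first by exists infinity => o _; right.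
  move=> [x [nKx clx]|_]; last by rewrite set0U; exact: connected1.
  apply: connectedU_adherent; last by exists infinity.
    exact/hat_connected/component_connected.
  exact: connected1.
Qed.

(** ** Bounded solid sets *)

(** The unbounded components of [~` A] all cling to the point at infinity. *)
Lemma solid_hat A : solid A -> connected (hat A) /\ connected (~` hat A).
Proof.
move=> [/(_ noncompactX)[cA unb] _]; split; first exact/hat_connected.
have -> : ~` hat A =
    \bigcup_(o in [set o | if o is Some x then ~ A x else True])
      ((if o is Some x then hat (connected_component (~` A) x) else set0)
       `|` [set infinity]).
  apply/seteqP; split=> [[x|] nAx|y].
  - have {}nAx : ~ A x by move=> Ax; apply: nAx; exact/hatP.
    by exists (Some x) => //; left; apply/hatP; exact: connected_component_refl.
  - by exists None => //; right.
  - move=> [[x|] nAx [|->]] //; try by move/hat_infinity.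
    by move=> [z /connected_component_sub nAz <-] /hatP.
apply: bigcup_connected; first by exists infinity => o _; right.
move=> [x nAx|_]; last by rewrite set0U; exact: connected1.
apply: connectedU_adherent.
- exact/hat_connected/component_connected.
- exact: connected1.
- exists infinity; split => //; apply: contrapT => /relatively_compactP.
  exact: unb nAx.
Qed.

(** A bounded component would be clopen in the connected set [~` hat A] when
[A] is closed; when [A] is open, boundary bumping lets every component reach
infinity. *)
Lemma solid_of_hat A : closed A \/ open A ->
  connected (hat A) -> connected (~` hat A) -> solid A.
Proof.
move=> clopA cA cCA; split => // _; split; first exact/hat_connected.
move=> x nAx; rewrite relatively_compactP => nclx; move: clopA => [clA|oA].
  have E : hat (connected_component (~` A) x) = ~` hat A.
    apply: cCA; first by exists (Some x); apply/hatP; exact: connected_component_refl.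
      exists (hat (connected_component (~` A) x)).
        exact/hat_open/component_open/closed_openC.
      apply/esym/setIidPr => _ [z /connected_component_sub nAz <-] /hatP.
      exact: nAz.
    exists (closure (hat (connected_component (~` A) x))).
      exact: closed_closure.
    apply/seteqP; split.
      move=> _ [z xz <-]; split; last exact/subset_closure/hatP.
      by move=> /hatP; exact: connected_component_sub xz.
    move=> [z|] [nAz clz] //; apply/hatP; apply: closure_component; split.
      move=> W zW.
      have [_ [[w xw <-] [v Wv [vw]]]] :=
        clz _ (hat_nbhs zW).
      by exists w; split => //; rewrite -vw.
    by move=> Az; apply: nAz; apply/hatP.
  have : (~` hat A) infinity by move/hat_infinity.
  by rewrite -E => /hat_infinity.
have cl_infty : closed [set infinity].
  exact/accessible_closed_set1/hausdorff_accessible/hausdorff_opc.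
have [|G [G' [oG oG' xG iG' GG'0]]] := closed_separation compact_opc hausdorff_opc
    (@closed_closure _ (hat (connected_component (~` A) x))) cl_infty.
  by rewrite -subset0 => y [+ yi]; rewrite yi.
have Gx : G (Some x).
  by apply/xG/subset_closure/hatP; exact: connected_component_refl.
have niG : ~ closure G infinity.
  move=> /(_ G' (open_nbhs_nbhs (conj oG' (iG' _ erefl)))) => -[y].
  by rewrite GG'0.
have := @component_reaches_boundary _ compact_opc hausdorff_opc (~` hat A) G (Some x).
apply => //.
- by apply: open_closedC; exact/hat_open.
- by move/hatP.
- move=> /(_ infinity (@hat_infinity A)) iG; apply: niG; exact: subset_closure.
- set D := connected_component _ _.
  have nD : ~ D infinity by move=> /connected_component_sub[].
  rewrite -(hat_trace nD) => _ [y Dy <-]; apply/xG/subset_closure/hatP.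
  have Dx : D (Some x).
    apply: connected_component_refl; split; first by move/hatP.
    exact: subset_closure.
  apply: (@connected_component_max _ _ (trace D)) Dy => //.
    by move=> z /connected_component_sub[nAz _] Az; apply: nAz; exact/hatP.
  apply/hat_connected; rewrite hat_trace //; exact: component_connected.
Qed.

Lemma compact_solid_hat K : compact_solid K <-> closed_solid (hat K).
Proof.
split.
  move=> [cK /solid_hat[coK ccK]]; split => //.
  exact/(compact_closed hausdorff_opc)/hat_compact.
move=> [clK coK ccK].
have cK : compact K.
  rewrite -(trace_hat K); apply: trace_compact; last exact: hat_infinity.
  exact: closed_compactY.
split => //; apply: solid_of_hat => //; left; exact: compact_closed.
Qed.

Lemma bounded_open_solid_hat V : bounded_open_solid V <->
  open_solid (hat V) /\ ~ closure (hat V) infinity.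
Proof.
split.
  move=> [oV /relatively_compactP bV /solid_hat[coV ccV]]; split => //.
  by split => //; exact/hat_open.
move=> [[oV coV ccV] /relatively_compactP bV]; split => //; first exact/hat_open.
by apply: solid_of_hat => //; right; exact/hat_open.
Qed.

(** * Restriction to the locally compact space *)

Section Restriction.
Variables (R : realType) (nu : set Xhat -> R) (mu : set X -> R).
Hypothesis genus0 : has_genus Xhat 0.
Hypothesis ssf_nu : solid_set_function nu.
Hypothesis muE : forall A, bounded_solid A -> mu A = nu (hat A).

Let haus := hausdorff_opc.
Let conn := connected_opc.
Let lconn := locally_connected_opc.

Lemma bounded_solid_hat A : bounded_solid A -> bounded_solid (hat A).
Proof.
move=> [/compact_solid_hat|/bounded_open_solid_hat[]].
  exact: closed_solid_bounded.
by move=> sA _; exact: open_solid_bounded.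
Qed.

Lemma trivIset_hat n (D : 'I_n -> set X) : trivIset setT D ->
  trivIset setT (fun i => hat (D i)).
Proof.
move=> /trivIsetP tD; apply/trivIsetP => i j _ _ ij.
by rewrite hat_disjoint // tD.
Qed.

Lemma compact_solid_trace (K : set Xhat) : closed_solid K -> ~ K infinity ->
  compact_solid (trace K).
Proof. by move=> sK nK; apply/compact_solid_hat; rewrite hat_trace. Qed.

Lemma closure_misses_infinity (B : set Xhat) :
  ~ closure B infinity -> ~ B infinity.
Proof. by apply: contra_not; exact: subset_closure. Qed.

Lemma bounded_open_solid_trace (V : set Xhat) : open_solid V ->
  ~ closure V infinity -> bounded_open_solid (trace V).
Proof.
move=> sV nV; apply/bounded_open_solid_hat.
by rewrite hat_trace //; exact: closure_misses_infinity.
Qed.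

Lemma mu_inner U : bounded_open_solid U -> (mu U)%:E =
  ereal_sup [set (mu K)%:E | K in [set K | compact_solid K /\ K `<=` U]].
Proof.
move=> sU; rewrite muE; last by right.
have [soU _] := (bounded_open_solid_hat _).1 sU.
rewrite (ssf_inner ssf_nu ((bounded_open_solidP compact_opc _).2 soU)).
congr ereal_sup; apply/seteqP; split=> _ [K [sK KU] <-]; last first.
  exists (hat K); last by rewrite muE //; left.
  split; last exact/hatS.
  exact/(compact_solidP compact_opc haus)/compact_solid_hat.
have {}sK := (compact_solidP compact_opc haus _).1 sK.
have nK : ~ K infinity by move=> /KU /hat_infinity.
have sK' := compact_solid_trace sK nK.
exists (trace K); last by rewrite muE ?hat_trace //; left.
by split => // x /KU /hatP.
Qed.

(** Outer approximation in the compactification is carried out inside an open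
neighbourhood of [K] whose closure misses infinity. *)
Lemma mu_outer K : compact_solid K -> (mu K)%:E =
  ereal_inf [set (mu U)%:E | U in [set U | bounded_open_solid U /\ K `<=` U]].
Proof.
move=> sK; have shK := (compact_solid_hat _).1 sK.
have muK : mu K = nu (hat K) by apply: muE; left.
apply/eqP; rewrite eq_le; apply/andP; split.
  apply: le_ereal_inf_tmp => _ [U [sU KU] <-]; rewrite lee_fin muK muE; last by right.
  have [soU _] := (bounded_open_solid_hat _).1 sU.
  by apply: (lam_closed_open compact_opc haus ssf_nu) => //; exact/hatS.
apply/lee_addgt0Pr => e e0.
have cl_infty : closed [set infinity].
  exact/accessible_closed_set1/hausdorff_accessible/haus.
have [|||W [W' [oW oW' KW iW' WW'0]]] :=
    @closed_separation _ compact_opc haus (hat K) [set infinity].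
- by case: shK.
- by [].
- by rewrite -subset0 => y [+ yi]; rewrite yi => /hat_infinity.
have [V [sV KV VW lt_V]] :=
  lam_outer_approx compact_opc haus conn lconn ssf_nu shK oW KW e0.
have nV : ~ closure V infinity.
  move=> /(_ W' (open_nbhs_nbhs (conj oW' (iW' _ erefl)))) [y [/VW Wy W'y]].
  by have : (W `&` W') y by []; rewrite WW'0.
have sV' := bounded_open_solid_trace sV nV.
have hV := hat_trace (closure_misses_infinity nV).
apply: (@le_trans _ _ (mu (trace V))%:E).
  apply: ereal_inf_lbound; exists (trace V) => //; split => //.
  by apply/hatS; rewrite hV.
rewrite -EFinD lee_fin muK muE; last by right.
by rewrite hV ltW.
Qed.

Lemma mu_solid_set_function : solid_set_function mu.
Proof.
split.
- move=> A sA; rewrite muE //; apply: (ssf_ge0 ssf_nu).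
  exact: bounded_solid_hat.
- move=> n D C sD sC tD DC; rewrite muE; last by left.
  rewrite (eq_bigr (fun i => nu (hat (D i)))); last first.
    by move=> i _; rewrite muE //; left; exact: sD.
  apply: (ssf_superadditive ssf_nu).
  + by move=> i; exact/(compact_solidP compact_opc haus)/compact_solid_hat.
  + exact/(compact_solidP compact_opc haus)/compact_solid_hat.
  + exact: trivIset_hat.
  + by move=> _ [i _ [x Dx <-]]; apply/hatP/DC; exists i.
- exact: mu_inner.
- exact: mu_outer.
- move=> n D A sD sA tD AD; rewrite muE //.
  rewrite (eq_bigr (fun i => nu (hat (D i)))); last by move=> i _; rewrite muE.
  apply: (ssf_additive ssf_nu).
  + by move=> i; exact: bounded_solid_hat.
  + exact: bounded_solid_hat.
  + exact: trivIset_hat.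
  + by rewrite AD image_bigcup.
Qed.

(** ** Existence of the extension *)

(** Outer regularity leaves no choice on closed sets that are not compact. *)
Definition restriction A : \bar R := ereal_inf
  [set (content nu (hat U))%:E | U in [set U | open U /\ A `<=` U]].

Lemma restriction_open U : open U -> restriction U = (content nu (hat U))%:E.
Proof.
move=> oU; apply/eqP; rewrite eq_le; apply/andP; split.
  by apply: ereal_inf_lbound; exists U => //; split.
apply: le_ereal_inf_tmp => _ [V [oV UV] <-]; rewrite lee_fin.
by apply: (content_mono compact_opc haus conn lconn genus0 ssf_nu); exact/hatS.
Qed.

Lemma hat_closed K : compact K -> closed (hat K).
Proof. by move=> cK; exact/(compact_closed haus)/hat_compact. Qed.

(** Intersecting a neighbourhood in the compactification with [X] only lowers its
content. *)
Lemma restriction_compact K : compact K ->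
  restriction K = (closed_content nu (hat K))%:E.
Proof.
move=> cK; have clK := hat_closed cK.
apply/eqP; rewrite eq_le; apply/andP; split; last first.
  apply: le_ereal_inf_tmp => _ [V [oV KV] <-]; rewrite lee_fin.
  apply: (closed_content_le compact_opc haus conn lconn genus0 ssf_nu) => //.
    exact/hat_open.
  exact/hatS.
apply/lee_addgt0Pr => e e0.
have [U [oU KU lt_U]] := closed_content_outer_approx compact_opc haus conn lconn
  genus0 ssf_nu clK e0.
apply: (@le_trans _ _ (content nu (hat (trace U)))%:E).
  apply: ereal_inf_lbound; exists (trace U) => //; split.
    exact: trace_open.
  by move=> x Kx; apply: KU; exact/hatP.
rewrite -EFinD lee_fin; apply: le_trans (ltW lt_U).
apply: (content_mono compact_opc haus conn lconn genus0 ssf_nu).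
by move=> _ [x Ux <-].
Qed.

Lemma restriction_extension A : compact A \/ open A ->
  restriction A = (extension nu (hat A))%:E.
Proof.
move=> [cA|oA].
  rewrite restriction_compact // extension_closed //; exact: hat_closed.
by rewrite restriction_open // extension_open //; exact/hat_open.
Qed.

Lemma hat_clop A : compact A \/ open A -> closed (hat A) \/ open (hat A).
Proof. by move=> [/hat_closed|/hat_open]; [left|right]. Qed.

Lemma restriction_topological_measure : topological_measure restriction.
Proof.
split.
- move=> A _; apply: le_ereal_inf_tmp => _ [U _ <-]; rewrite lee_fin.
  exact: content_ge0.
- by exists set0; [right; exact: open0|rewrite restriction_open //; exact: open0].
- move=> A B clopA clopB clopAB AB0; rewrite !restriction_extension //.
  rewrite image_setU (extension_additive compact_opc haus conn lconn genus0 ssf_nu).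
  + by rewrite EFinD.
  + exact: hat_clop.
  + exact: hat_clop.
  + by rewrite -image_setU; exact: hat_clop.
  + exact: hat_disjoint.
- move=> U oU; rewrite restriction_open //; apply/eqP; rewrite eq_le.
  apply/andP; split; last first.
    apply: ge_ereal_sup => _ [K [cK KU] <-]; rewrite restriction_compact // lee_fin.
    apply: (closed_content_le compact_opc haus conn lconn genus0 ssf_nu).
    + exact: hat_closed.
    + exact/hat_open.
    + exact/hatS.
  apply/lee_addgt0Pr => e e0.
  have [K [clK KU lt_K]] := content_inner_approx compact_opc haus conn lconn
    genus0 ssf_nu ((hat_open _).2 oU) e0.
  have nK : ~ K infinity by move=> /KU /hat_infinity.
  have cK : compact (trace K).
    by apply: trace_compact => //; exact: closed_compactY.
  rewrite -leeBlDr // -EFinB.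
  apply: (@le_trans _ _ (restriction (trace K))).
    by rewrite restriction_compact // hat_trace // lee_fin ltW.
  apply: ereal_sup_ubound; exists (trace K) => //; split => //.
  by move=> x /KU /hatP.
- move=> F clF; rewrite {1}/restriction; congr ereal_inf.
  by apply: eq_imagel => U [oU _]; rewrite restriction_open.
Qed.

Lemma restriction_extends : extends_solid_set_function mu restriction.
Proof.
move=> A sA; rewrite muE //.
case: sA => [sA|sA].
  rewrite restriction_compact; last by case: sA.
  rewrite (closed_content_solid compact_opc haus conn lconn genus0 ssf_nu) //.
  exact/compact_solid_hat.
rewrite restriction_open; last by case: sA.
rewrite (content_open_solid compact_opc haus conn lconn genus0 ssf_nu) //.
by have [] := (bounded_open_solid_hat _).1 sA.
Qed.

(** ** Uniqueness of the extension *)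

Section Uniqueness.
Variable m : set X -> \bar R.
Hypothesis tm_m : topological_measure m.
Hypothesis ext_m : extends_solid_set_function mu m.

Lemma tm_compact_mono K L : compact K -> compact L -> K `<=` L ->
  (m K <= m L)%E.
Proof.
move=> cK cL KL; rewrite (tm_outer tm_m (compact_closed hausX cL)).
apply: le_ereal_inf_tmp => _ [U [oU LU] <-]; rewrite (tm_inner tm_m oU).
apply: ereal_sup_ubound; exists K => //; split => //.
exact: subset_trans LU.
Qed.

Lemma compact_solid_set0 : compact_solid (@set0 X).
Proof.
apply/compact_solid_hat; rewrite hat_set0; split; first exact: closed0.
  exact: connected0.
by rewrite setC0.
Qed.

Lemma tm_set0 : m set0 = 0%E.
Proof.
rewrite ext_m; last by left; exact: compact_solid_set0.
rewrite muE; last by left; exact: compact_solid_set0.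
by rewrite hat_set0 (lam_set0 compact_opc haus conn ssf_nu).
Qed.

Lemma tm_union_open (vs : seq (set Xhat)) : disjoint_family vs ->
  (forall V : set Xhat, V \in vs -> open V /\ m (trace V) = (nu V)%:E) ->
  m (trace (union vs)) = (\sum_(V <- vs) nu V)%:E.
Proof.
elim: vs => [|V vs IH] dvs mvs.
  by rewrite union_nil preimage_set0 big_nil tm_set0.
have /disjoint_family_cons[Vvs0 dvs'] := dvs.
have mvs' W : W \in vs -> open W /\ m (trace W) = (nu W)%:E.
  by move=> Wvs; apply: mvs; rewrite inE Wvs orbT.
have [oV mV] := mvs V (mem_head _ _).
have ovs : open (union vs) by apply: open_union => W /mvs'[].
rewrite union_cons preimage_setU (tm_additive tm_m).
- by rewrite mV IH // big_cons EFinD.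
- by right; exact: trace_open.
- by right; exact: trace_open.
- by right; apply: openU; exact: trace_open.
- by rewrite -preimage_setI Vvs0 preimage_set0.
Qed.

(** The complementary components of a tile that misses infinity are, except for
the one containing infinity, bounded solid sets; the tile is obtained by removing
them from the solid hull that the exceptional one bounds. *)
Lemma tm_region t : tile t -> ~ region t infinity ->
  m (trace (region t)) = (weight nu t)%:E.
Proof.
move=> tt nt; have clt := region_closed tt; have [dt sol _] := tt.
have [V Vt Vi] : union t infinity by apply: contrapT.
have sV := sol _ Vt; have [oV _ _] := sV.
case/splitPr: Vt tt nt clt dt sol => t1 t2 tt nt clt dt sol.
pose rest := t1 ++ t2.
have /disjoint_family_cons[Vrest0 drest] := disjoint_family_move dt.
have trest W : W \in rest -> open_solid W.
  by move=> Wr; apply: sol; move: Wr; rewrite !mem_cat inE => /orP[->|->];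
    rewrite ?orbT.
have tE : union (t1 ++ V :: t2) = V `|` union rest.
  by rewrite /rest !union_cat union_cons setUCA.
have nrest : ~ closure (union rest) infinity.
  move=> /(_ V (open_nbhs_nbhs (conj oV Vi)))[y [ry Vy]].
  by have : (V `&` union rest) y by []; rewrite Vrest0.
have mrest : m (trace (union rest)) = (\sum_(W <- rest) nu W)%:E.
  apply: tm_union_open => // W Wr; have [oW _ _] := trest _ Wr.
  have nW : ~ closure W infinity.
    by move=> cW; apply: nrest; move: cW; apply: closureS; exact: union_sup.
  split => //; have sW : bounded_solid (trace W).
    by right; apply: bounded_open_solid_trace => //; exact: trest.
  by rewrite ext_m // muE // hat_trace //; exact: closure_misses_infinity.
have sS : compact_solid (trace (~` V)).
  by apply: compact_solid_trace; [exact: open_solidC|move=> nV; exact: nV].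
have mS : m (trace (~` V)) = (nu (~` V))%:E.
  by rewrite ext_m ?muE ?hat_trace //; left.
have SE : ~` V = region (t1 ++ V :: t2) `|` union rest.
  rewrite /region tE setCU; apply/seteqP; split=> y.
    by move=> nVy; have [?|?] := pselect (union rest y); [right|left].
  by move=> [[]//|ry Vy]; have : (V `&` union rest) y by []; rewrite Vrest0.
move: mS; rewrite SE preimage_setU (tm_additive tm_m).
- rewrite mrest -SE (lam_openC compact_opc haus conn ssf_nu sV).
  rewrite /weight /rest !big_cat big_cons /=.
  case: (m _) => [r| |] //; rewrite -EFinD => -[rE]; congr _%:E.
  by move: rE; lra.
- by left; apply: trace_compact => //; exact: closed_compactY.
- by right; apply: trace_open; apply: open_union => W /trest[].
- by left; rewrite -preimage_setU -SE; case: sS.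
- rewrite -preimage_setI (_ : _ `&` _ = set0) ?preimage_set0 //.
  rewrite /region tE setCU -subset0 => y [[_ nr] r]; exact: nr.
Qed.

Lemma tm_tiling U ts : tiling (hat U) ts ->
  m (trace (union (map (@region _) ts))) = (tiling_weight nu ts)%:E.
Proof.
elim: ts => [|t ts IH].
  by rewrite /tiling_weight big_nil /= union_nil preimage_set0 tm_set0.
move=> /tiling_cons[tt tU tts0 tlt]; have [tl dts tsU] := tlt.
have clts : closed (union (map (@region Xhat) ts)).
  by apply: closed_union => _ /mapP[t' /tl tt' ->]; exact: region_closed tt'.
have nt : ~ region t infinity by move=> /tU /hat_infinity.
have nts : ~ union (map (@region Xhat) ts) infinity by move=> /tsU /hat_infinity.
have ct : compact (trace (region t)).
  by apply: trace_compact => //; apply: closed_compactY => //; exact: region_closed tt.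
have cts : compact (trace (union (map (@region Xhat) ts))).
  by apply: trace_compact => //; exact: closed_compactY.
rewrite /= union_cons preimage_setU (tm_additive tm_m).
- by rewrite tiling_weight_cons IH // tm_region // EFinD.
- by left.
- by left.
- by left; exact: compactU.
- by rewrite -preimage_setI tts0 preimage_set0.
Qed.

(** Tilings inside [hat U] are cofinal among its compact subsets, and on their
unions the values of [m] are prescribed. *)
Lemma tm_open_unique U : open U -> m U = (content nu (hat U))%:E.
Proof.
move=> oU; have ohU := (hat_open _).2 oU.
have compact_tiling ts : tiling (hat U) ts ->
    compact (trace (union (map (@region Xhat) ts))).
  move=> [tl _ tsU]; apply: trace_compact; last by move=> /tsU /hat_infinity.
  apply: closed_compactY => //; apply: closed_union => _ /mapP[t /tl tt ->].
  exact: region_closed tt.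
apply/eqP; rewrite eq_le; apply/andP; split.
  rewrite (tm_inner tm_m oU); apply: ge_ereal_sup => _ [K [cK KU] <-].
  have [ts tlt Kts] := tiling_cover compact_opc haus conn lconn genus0
    ohU (hat_closed cK) ((hatS _ _).2 KU).
  apply: (@le_trans _ _ (m (trace (union (map (@region Xhat) ts))))).
    apply: tm_compact_mono => //; first exact: compact_tiling.
    by move=> x Kx; apply: Kts; exact/hatP.
  rewrite (tm_tiling tlt) lee_fin.
  exact: (content_ge compact_opc haus conn lconn genus0 ssf_nu).
apply/lee_addgt0Pr => e e0.
have [ts tlt lt_ts] := content_approx compact_opc haus conn lconn genus0 ssf_nu
  (hat U) e0.
rewrite -leeBlDr // -EFinB.
apply: (@le_trans _ _ (m (trace (union (map (@region Xhat) ts))))).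
  by rewrite (tm_tiling tlt) lee_fin ltW.
rewrite (tm_inner tm_m oU); apply: ereal_sup_ubound.
exists (trace (union (map (@region Xhat) ts))) => //; split.
  exact: compact_tiling.
by have [_ _ tsU] := tlt; move=> x /tsU /hatP.
Qed.

Lemma tm_unique A : closed A \/ open A -> m A = restriction A.
Proof.
move=> [clA|oA]; last by rewrite tm_open_unique // restriction_open.
rewrite (tm_outer tm_m clA); congr ereal_inf.
by apply: eq_imagel => U [oU _]; exact: tm_open_unique.
Qed.

End Uniqueness.
End Restriction.

End OnePointCompactification.

Theorem theorem15p8 (R : realType) (X : topologicalType)
    (hausX : hausdorff_space X)
    (noncompactX : ~ compact [set: X])
    (lcompactX : locally_compact [set: X])
    (connX : connected [set: X])
    (lconnX : locally_connected X)
    (genus0 : has_genus (one_point_compactification X) 0)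
    (nu : set (one_point_compactification X) -> R)
    (nu_ssf : solid_set_function nu)
    (mu : set X -> R)
    (muE : forall A : set X, bounded_solid A -> mu A = nu (Some @` A)) :
  solid_set_function mu /\
  exists m : set X -> \bar R,
    [/\ topological_measure m,
        extends_solid_set_function mu m &
        forall m' : set X -> \bar R,
          topological_measure m' -> extends_solid_set_function mu m' ->
          forall A : set X, closed A \/ open A -> m' A = m A].
Proof.
split.
  exact: (mu_solid_set_function hausX noncompactX lcompactX connX lconnX nu_ssf muE).
exists (restriction nu); split.
- exact: restriction_topological_measure.
- exact: restriction_extends.
- by move=> m' tm_m' ext_m'; 
  exact: (tm_unique hausX noncompactX lcompactX connX lconnX genus0 nu_ssf muE).
Qed.
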